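(* Let $t>1$ be fixed and let $K\subset\mathbb{C}$ be a compact set with $\operatorname{cap}(K)=t$. Let $\{f_n\}_{n\in\mathbb{N}}$ be a sequence of Fekete polynomials for $K$, where $f_n$ has degree $n$. Then $$\lim_{n\to\infty}\frac1n\log A_n(K)=\lim_{n\to\infty}\frac1n\log m(\Lambda_{f_n})=-2\log t .$$
   Context: For a complex polynomial $p$, its unit lemniscate is $\Lambda_p=\{z\in\mathbb{C}:|p(z)|<1\}$. For a compact set $K\subset\mathbb{C}$ and $n\in\mathbb{N}$ (with $n\ge 1$), $\mathscr{P}_n(K)$ denotes the set of monic polynomials of degree $n$ all of whose zeros lie in $K$, i.e. $p(z)=\prod_{j=1}^n(z-z_j)$ with $z_j\in K$ (repetitions allowed). Let $m$ be Lebesgue (area) measure on $\mathbb{C}$, and define $A_n(K)=\inf_{p\in\mathscr{P}_n(K)}m(\Lambda_p)$. The logarithmic capacity $\operatorname{cap}(K)$ is defined by $\log\operatorname{cap}(K)=\sup_{\mu\in\mathcal{P}(K)}\int_K U_\mu(z)\,d\mu(z)$, where $\mathcal{P}(K)$ is the set of Borel probability measures on $K$ and $U_\mu(z)=\int_K\log|z-w|\,d\mu(w)$ (with $\operatorname{cap}(K)=0$ if the supremum is $-\infty$). A Fekete $n$-tuple of $K$ is an $n$-tuple $(z_1,\dots,z_n)\in K^n$ that realizes the supremum of $\prod_{1\le j<k\le n}|w_j-w_k|^{2/(n(n-1))}$ over all $w_1,\dots,w_n\in K$ (for $n=1$ any point of $K$). The corresponding polynomial $f_n(z)=\prod_{k=1}^n(z-z_k)$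 is called a Fekete polynomial of degree $n$ for $K$. *)

(* Defs.v *)
From HB Require Import structures.
From mathcomp Require Import all_boot all_order all_algebra.
From mathcomp Require Import complex.
From mathcomp Require Import all_classical all_reals all_analysis.

Set Implicit Arguments.
Unset Strict Implicit.
Unset Printing Implicit Defensive.

Import Order.TTheory GRing.Theory Num.Theory numFieldNormedType.Exports.

Local Open Scope classical_set_scope.
Local Open Scope ring_scope.
Local Open Scope complex_scope.

(* MathComp-Analysis topologizes a numFieldType [F] through its copy [F^o];
   [planeC R] is thus [R[i]] with the topology of its modulus. *)
Notation planeC R := (R[i]^o).

Notation borelC R := (g_sigma_algebraType (@open (planeC R))).

(* The modulus as an element of [R]; the generic norm [`|z|] lives in [R[i]]. *)
Definition modC (R : realType) (z : R[i]) : R := ComplexField.Normc.normc z.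

Definition area (R : realType) (A : set R[i]) : \bar R :=
  ((@lebesgue_measure R) \x (@lebesgue_measure R))%E
    [set xy : R * R | A (xy.1 +i* xy.2)].

Definition lemniscate (R : realType) (p : {poly R[i]}) : set R[i] :=
  [set z | modC p.[z] < 1].

Definition poly_of_roots (R : realType) (n : nat) (z : 'I_n -> R[i]) :
  {poly R[i]} := \prod_(j < n) ('X - (z j)%:P).

Definition tuples_in (R : realType) (K : set R[i]) (n : nat) :
  set ('I_n -> R[i]) := [set z | forall j, K (z j)].
Arguments tuples_in {R} K n.

Definition polys_with_roots_in (R : realType) (K : set R[i]) (n : nat) :
  set {poly R[i]} :=
  [set p | exists2 z : 'I_n -> R[i], tuples_in K n z & p = poly_of_roots z].

Definition min_area (R : realType) (K : set R[i]) (n : nat) : \bar R :=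
  ereal_inf [set area (lemniscate p) | p in polys_with_roots_in K n].

(* [lne 0 = -oo], so the kernel is log|z - w| with value -oo on the diagonal. *)
Definition log_potential (R : realType) (K : set R[i])
    (mu : probability (borelC R) R) (z : R[i]) : \bar R :=
  (\int[mu]_(w in (K : set (borelC R))) lne (modC (z - w))%:E)%E.

Definition log_energy (R : realType) (K : set R[i])
    (mu : probability (borelC R) R) : \bar R :=
  (\int[mu]_(z in (K : set (borelC R))) log_potential K mu z)%E.

(* A Borel probability measure on [K] is a Borel probability measure on the
   plane giving full mass to [K]. As [expeR -oo = 0], [capacity K] is 0 when
   the supremum is -oo. *)
Definition capacity (R : realType) (K : set R[i]) : \bar R :=
  expeR (ereal_sup [set log_energy K mu |
    mu in [set mu : probability (borelC R) R | mu K = 1%E]]).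

(* For [n = 1] the product is empty, and the junk exponent [2 / 0] is unused. *)
Definition pairwise_mean (R : realType) (n : nat) (z : 'I_n -> R[i]) : R :=
  \prod_(j < n) \prod_(k < n | (j < k)%N)
    (modC (z j - z k) `^ (2 / (n * n.-1)%:R)).

Definition fekete_tuple (R : realType) (K : set R[i]) (n : nat)
    (z : 'I_n -> R[i]) : Prop :=
  tuples_in K n z /\
  (pairwise_mean z)%:E =
    ereal_sup [set (pairwise_mean w)%:E | w in tuples_in K n].

Definition fekete_poly (R : realType) (K : set R[i]) (n : nat)
    (p : {poly R[i]}) : Prop :=
  exists2 z : 'I_n -> R[i], fekete_tuple K z & p = poly_of_roots z.

(* Main.v *)
Require Import Defs.
From HB Require Import structures.
From mathcomp Require Import all_boot all_order all_algebra.
From mathcomp Require Import complex.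
From mathcomp Require Import all_classical all_reals all_analysis.
From mathcomp Require Import fingroup perm measurable_realfun.
From mathcomp Require Import ring lra zify.

(** Let [t > 1] be the capacity of [K]. Since the least area is at most the area
    for the Fekete polynomial, two estimates suffice, both up to factors
    [exp (o(n))]: the Fekete lemniscate has area at most [t ^ (- 2 n)], and every
    lemniscate of a monic polynomial of degree [n] with roots in [K] has area at
    least [t ^ (- 2 n)].

    Upper bound. For [n] distinct points [z_j] and [f = prod_j (X - z_j)],
    Lagrange interpolation of the constant [1] reads
    [1 = sum_j f(x) / (f'(z_j) (x - z_j))] for all complex [x]. Hence if
    [|f(x)| < 1] and all [|f'(z_j)| >= D], then [x] is within [n / D] of a root
    ([lemniscate_near_roots]), and the area is at most [n (2 n / D)^2]. For Fekete
    points, maximality says that [|f'(z_j)|] is the maximum over [K] of the monic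
    polynomial [f / (X - z_j)], and such a maximum is at least [t ^ (n - 1)]
    ([monic_sup_ge], [fekete_derivative_ge]). The latter compares two estimates
    of Vandermonde products of points of [K]: by a conditional expectation
    argument, any measure of energy [I] yields [N] points with product at least
    [exp (I N^2 / 2 - O(N))] ([exists_low_energy], [exists_spread_points]),
    whereas a monic polynomial [q] small on [K] would, by row operations, make
    all such determinants small ([Vandermonde_le]).

    Lower bound. Suppose that for infinitely many [n] some polynomial has area
    less than [exp (- 2 n (ln t + e))]. Along an ultrafilter the root counting
    measures have a weak limit [mu] on [K] ([exists_weak_limit]). Let [x] be in
    the support of [mu]. If the potential of [mu] at [x] were less than
    [ln t + e / 2], then near [x] the polynomials would be at most
    [exp (n (ln t + 3 e / 4))]; as they have roots arbitrarily close to [x], they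
    would be less than [1] on discs of radius [exp (- n (ln t + 3 e / 4))] up to a
    constant ([area_ge_of_truncated_mean]), which is too large an area. So the
    potential is at least [ln t + e / 2] on the support, and so is the energy of
    [mu], contradicting that [ln t] is the maximal energy
    ([log_energy_pushforward_ge], [area_lemniscate_eventually_ge]). *)

Set Implicit Arguments.
Unset Strict Implicit.
Unset Printing Implicit Defensive.

Import Order.TTheory GRing.Theory Num.Theory numFieldNormedType.Exports.

Local Open Scope classical_set_scope.
Local Open Scope ring_scope.
Local Open Scope complex_scope.

(** * The modulus and the topology of the plane *)

Section Modulus.
Variable R : realType.
Implicit Types z w : R[i].

Lemma modC_norm z : (modC z)%:C = `|z|. Proof. by case: z. Qed.

Lemma modC_ge0 z : 0 <= modC z. Proof. by case: z => a b; rewrite sqrtr_ge0. Qed.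

Lemma modC0 : modC (0 : R[i]) = 0. Proof. exact: ComplexField.Normc.normc0. Qed.

Lemma modCM z w : modC (z * w) = modC z * modC w.
Proof. exact: ComplexField.Normc.normcM. Qed.

Lemma modC1 : modC (1 : R[i]) = 1. Proof. exact: ComplexField.Normc.normc1. Qed.

Lemma modCX z n : modC (z ^+ n) = modC z ^+ n.
Proof. by elim: n => [|n IHn]; rewrite ?expr0 ?modC1// !exprS modCM IHn. Qed.

Lemma modC_prod (I : Type) (r : seq I) (P : pred I) (f : I -> R[i]) :
  modC (\prod_(i <- r | P i) f i) = \prod_(i <- r | P i) modC (f i).
Proof. exact: (big_morph _ modCM modC1). Qed.

Lemma ler_modCD z w : modC (z + w) <= modC z + modC w.
Proof. by rewrite -lecR rmorphD /= !modC_norm ler_normD. Qed.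

Lemma modCN z : modC (- z) = modC z.
Proof. by apply: complexI; rewrite !modC_norm normrN. Qed.

Lemma modCB z w : modC (z - w) = modC (w - z).
Proof. by rewrite -modCN opprB. Qed.

Lemma ler_modC_sum (I : Type) (r : seq I) (P : pred I) (f : I -> R[i]) :
  modC (\sum_(i <- r | P i) f i) <= \sum_(i <- r | P i) modC (f i).
Proof.
elim/big_rec2: _ => [|i u z _ IH]; first by rewrite modC0.
by apply: le_trans (ler_modCD _ _) _; rewrite lerD2l.
Qed.

Lemma ler_modC_dist z w u : modC (z - u) <= modC (z - w) + modC (w - u).
Proof. by rewrite (le_trans _ (ler_modCD _ _))// addrA subrK. Qed.

Lemma ler_dist_modC z w : `|modC z - modC w| <= modC (z - w).
Proof.
rewrite ler_distlC; apply/andP; split.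
- by have := ler_modCD (z - w) w; rewrite subrK; lra.
- by have := ler_modCD (w - z) z; rewrite subrK (modCB w); lra.
Qed.

Lemma ler_Re_modC z : `|complex.Re z| <= modC z.
Proof. by rewrite -lecR modC_norm normc_ge_Re. Qed.

Lemma ler_Im_modC z : `|complex.Im z| <= modC z.
Proof.
case: z => a b /=; rewrite -(ger0_norm (sqrtr_ge0 _)) -ler_sqr ?nnegrE//.
by rewrite !real_normK ?num_real// sqr_sqrtr ?addr_ge0 ?sqr_ge0// lerDr sqr_ge0.
Qed.

Lemma ler_modC_Re_Im z : modC z <= `|complex.Re z| + `|complex.Im z|.
Proof.
case: z => a b /=; rewrite -[leRHS]ger0_norm ?addr_ge0// -sqrtr_sqr ler_sqrt ?sqr_ge0//.
rewrite sqrrD !real_normK ?num_real// -addrA lerD2l lerDr.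
by rewrite mulrn_wge0// mulr_ge0.
Qed.

(** [planeC R] measures distances in [R[i]]; these lemmas bring its topology
    back to radii in [R]. *)
Lemma nbhs_planeC (z : planeC R) (A : set (planeC R)) :
  nbhs z A <-> exists2 r : R, 0 < r & forall w, modC (z - w) < r -> A w.
Proof.
split.
- move=> /nbhs_ballP[[a b]/=]; rewrite ltcE/= => /andP[/eqP b0 a0] H.
  exists a => // w zw; apply: H.
  by rewrite /ball/= -modC_norm ltcE/= b0 eqxx.
- move=> [r r0 H]; apply/nbhs_ballP; exists r%:C => /=; first by rewrite ltcR.
  by move=> w; rewrite /ball/= -modC_norm ltcR; exact: H.
Qed.

Lemma open_planeC (A : set (planeC R)) :
  open A <-> forall z, A z -> exists2 r : R, 0 < r & forall w, modC (z - w) < r -> A w.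
Proof.
rewrite openE; split => H z Az; apply/nbhs_planeC; exact: H.
Qed.

Lemma open_disc (z : R[i]) (r : R) : open ([set w | modC (z - w) < r] : set (planeC R)).
Proof.
apply/open_planeC => w /= zw; exists (r - modC (z - w)); first by rewrite subr_gt0.
by move=> u wu; have := ler_modC_dist z w u; lra.
Qed.

Lemma measurable_open_borelC (A : set (planeC R)) :
  open A -> measurable (A : set (borelC R)).
Proof. by move=> oA; apply: sub_gen_smallest. Qed.

Lemma measurable_closed_borelC (A : set (planeC R)) :
  closed A -> measurable (A : set (borelC R)).
Proof.
move=> cA; rewrite -(setCK A); apply: measurableC.
by apply: measurable_open_borelC; exact: closed_openC.
Qed.

Lemma hausdorff_planeC : hausdorff_space (planeC R).
Proof. exact: norm_hausdorff. Qed.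

Lemma measurable_compact_borelC (A : set (planeC R)) :
  compact A -> measurable (A : set (borelC R)).
Proof.
by move=> cA; apply: measurable_closed_borelC; apply: (compact_closed hausdorff_planeC).
Qed.

Lemma measurable_lipschitz_borelC (f : R[i] -> R) (L : R) :
  0 < L -> (forall z w, `|f z - f w| <= L * modC (z - w)) ->
  measurable_fun setT (f : borelC R -> R).
Proof.
move=> L0 Lf; apply: (measurability _ (measurable_realfun.RGenOInfty.measurableE R)).
move=> _ [_ [a ->] <-].
apply: measurableI => //; apply: measurable_open_borelC; apply/open_planeC => z.
rewrite /= in_itv/= andbT => az; exists ((f z - a) / L).
  by rewrite divr_gt0// subr_gt0.
move=> w zw; rewrite /= in_itv/= andbT.
have := Lf z w; rewrite ler_distl => /andP[_ H].
move: zw; rewrite ltr_pdivlMr// mulrC => zw; lra.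
Qed.

Lemma compact_planeC_bounded (K : set (planeC R)) : compact K ->
  exists2 B : R, 1 <= B & forall z, K z -> modC z <= B.
Proof.
rewrite compact_cover => Kc.
have [||D _ KD] := Kc nat setT (fun n => [set w | modC (0 - w) < n%:R]).
- by move=> n _; exact: open_disc.
- move=> z _; exists (Num.bound (modC z)) => //=.
  by rewrite sub0r modCN; apply: le_lt_trans (archi_boundP (modC_ge0 z)).
pose B := \big[Num.max/1]_(n <- finmap.enum_fset D) (n%:R : R).
exists B; first exact: bigmax_ge_id.
move=> z /KD[n nD /=]; rewrite sub0r modCN => /ltW/le_trans; apply.
exact: (@le_bigmax_seq _ _ _ _ _ _ xpredT).
Qed.

Lemma compact_planeC_net (K : set (planeC R)) (e : R) : compact K -> 0 < e ->
  exists s : seq R[i], forall z, K z -> exists2 c, c \in s & modC (c - z) < e.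
Proof.
rewrite compact_cover => Kc e0.
have [||D _ KD] := Kc R[i] setT (fun c => [set w | modC (c - w) < e]).
- by move=> n _; exact: open_disc.
- by move=> z _; exists z => //=; rewrite subrr modC0.
by exists (finmap.enum_fset D) => z /KD[c cD /= cz]; exists c.
Qed.

End Modulus.

(** * Point configurations of low energy *)

Section ProbabilityIntegrals.
Context d (T : measurableType d) (R : realType) (mu : probability T R).
Variables (D : set T) (mD : measurable D) (muD : mu D = 1%E).
Local Open Scope ereal_scope.

Lemma integral_cst_probability (r : R) : \int[mu]_(x in D) r%:E = r%:E.
Proof. by rewrite integral_cst// -[RHS]mule1; congr (_ * _); exact: muD. Qed.

(** No integrability is assumed: when [g] has infinite integral, the negative
    part of [M - g] carries the divergence and both sides are [-oo]. *)
Lemma integral_cstB (M : R) (g : T -> \bar R) : measurable_fun D g ->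
  (forall x, D x -> 0 <= g x) ->
  \int[mu]_(x in D) (M%:E - g x) = M%:E - \int[mu]_(x in D) g x.
Proof.
move=> mg g0; have ig0 : 0 <= \int[mu]_(x in D) g x by exact: integral_ge0.
have icst r : mu.-integrable D (cst r%:E) by exact: finite_measure_integrable_cst.
have [gy|] := ltP (\int[mu]_(x in D) g x) +oo.
  have ig : mu.-integrable D g.
    apply/integrableP; split => //.
    by under eq_integral => x /set_mem Dx do rewrite gee0_abs ?g0//.
  by rewrite (integralB mD (icst M) ig)/= integral_cst_probability.
rewrite leye_eq => /eqP gy; rewrite gy /=.
pose f x := M%:E - g x.
have mf : measurable_fun D f by apply: emeasurable_funB => //; exact: measurable_cst.
rewrite integralE.
have fneg : \int[mu]_(x in D) (f^\- x) = +oo.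
  apply/eqP; rewrite -leye_eq leNgt; apply/negP => fy.
  have : \int[mu]_(x in D) g x <= \int[mu]_(x in D) (f^\- x + `|M|%:E).
    apply: ge0_le_integral => //.
    - by apply: emeasurable_funD => //; exact: measurable_funeneg.
    - move=> x Dx; rewrite funenegE /f; have := g0 x Dx.
      case: (g x) => [r r0| |]//=; rewrite /maxe/=.
      case: ifPn; rewrite -?leNgt ?lte_fin ?lee_fin ?add0e -?EFinD ?lee_fin => H;
        by have := ler_norm M; lra.
  rewrite gy ge0_integralD//; last exact: measurable_funeneg.
  rewrite integral_cst_probability leye_eq => /eqP H.
  by move: fy; case: (\int[mu]_(x in D) _) H.
rewrite -/f fneg; set I := (X in X - _).
have : I <= `|M|%:E.
  rewrite -integral_cst_probability; apply: ge0_le_integral => //.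
  - exact: measurable_funepos.
  - move=> x Dx; rewrite funeposE /f; have := g0 x Dx.
    case: (g x) => [r r0| |]//=; rewrite /maxe/=.
    move: r0; case: ifPn => _; rewrite !lee_fin;
      by have := ler_norm M; have := normr_ge0 M; lra.
  by rewrite addeNy ltNy0 lee_fin.
by case: I.
Qed.

(** The slack [1] replaces a discussion of whether the mean is attained; it
    will only contribute a linear term to an energy of quadratic order. *)
Lemma exists_le_mean (h : T -> \bar R) : measurable_fun D h ->
  (forall x, D x -> 0 <= h x) ->
  exists2 x, D x & h x <= \int[mu]_(x in D) h x + 1.
Proof.
move=> mh h0; apply: contrapT => nh.
have hgt x : D x -> \int[mu]_(x in D) h x + 1 <= h x.
  by move=> Dx; apply: ltW; rewrite ltNge; apply/negP => ?; apply: nh; exists x.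
have ih0 : 0 <= \int[mu]_(x in D) h x by exact: integral_ge0.
have iy : \int[mu]_(x in D) h x < +oo.
  rewrite ltNge leye_eq; apply/negP => /eqP iy.
  have /set0P[x Dx] : D != set0.
    by apply/eqP => D0; move: muD; rewrite D0 measure0 => /esym/eqP; rewrite onee_eq0.
  by apply: nh; exists x => //; rewrite iy addye// leey.
have : \int[mu]_(x in D) (\int[mu]_(x in D) h x + 1) <= \int[mu]_(x in D) h x.
  by apply: ge0_le_integral => //; move=> *; rewrite adde_ge0.
move: ih0 iy; case: (\int[mu]_(x in D) h x) => [r| |]//= _ _.
by rewrite -EFinD integral_cst_probability lee_fin; lra.
Qed.

Fixpoint pair_energy (k : T -> T -> \bar R) (s : seq T) : \bar R :=
  if s is x :: s' then \sum_(y <- s') k x y + pair_energy k s' else 0.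

(** The points are picked one at a time, each one making the conditional
    expectation of the total energy (all later points being random with law
    [mu]) at most its mean plus [1]. The field [g] stands for the interaction
    with the points already picked, which is what makes the induction close;
    only one-variable integrals occur. *)
Lemma exists_low_energy (k : T -> T -> \bar R) (n : nat) (g : T -> \bar R) :
  (forall x y, D x -> D y -> 0 <= k x y) ->
  (forall x, D x -> measurable_fun D (k x)) ->
  measurable_fun D (fun x => \int[mu]_(y in D) k x y) ->
  measurable_fun D g -> (forall x, D x -> 0 <= g x) ->
  exists s : seq T, [/\ size s = n, (forall x, x \in s -> D x) &
    \sum_(x <- s) g x + pair_energy k s <=
      n%:R%:E * \int[mu]_(x in D) g x +
      'C(n, 2)%:R%:E * \int[mu]_(x in D) \int[mu]_(y in D) k x y + n%:R%:E].
Proof.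
move=> k0 mk mV; elim: n g => [|n IHn] g mg g0.
  by exists [::]; split => //=; rewrite big_nil mul0e bin_small// mul0e !adde0.
pose V x := \int[mu]_(y in D) k x y.
have V0 x : D x -> 0 <= V x by move=> Dx; apply: integral_ge0 => y; exact: k0.
pose E := \int[mu]_(x in D) V x.
have E0 : 0 <= E by exact: integral_ge0.
have ig0 : 0 <= \int[mu]_(x in D) g x by exact: integral_ge0.
have nV0 x : D x -> 0 <= n%:R%:E * V x.
  by move=> Dx; rewrite mule_ge0 ?V0// lee_fin.
have mnV : measurable_fun D (fun x => n%:R%:E * V x) by exact: measurable_funeM.
have [||x Dx hx] := @exists_le_mean (fun x => g x + n%:R%:E * V x).
- exact: emeasurable_funD.
- by move=> x Dx; rewrite adde_ge0// ?g0// nV0.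
rewrite ge0_integralD// ge0_integralZl//= -/E in hx.
(* the point just picked becomes part of the field seen by the others *)
have [||s [ss sD hs]] := IHn (fun y => g y + k x y).
- by apply: emeasurable_funD => //; exact: mk.
- by move=> y Dy; rewrite adde_ge0// ?g0// k0.
exists (x :: s); split => /=; first by rewrite ss.
  by move=> y; rewrite in_cons => /predU1P[->//|/sD].
rewrite big_cons.
have sumD : \sum_(y <- s) (g y + k x y) = \sum_(y <- s) g y + \sum_(y <- s) k x y.
  exact: big_split.
rewrite sumD ge0_integralD// -/(V x) in hs; last 2 first.
- by move=> y; exact: k0.
- exact: mk.
have -> : g x + \sum_(j <- s) g j + (\sum_(y <- s) k x y + pair_energy k s) =
    g x + (\sum_(y <- s) g y + \sum_(y <- s) k x y + pair_energy k s).
  by rewrite !addeA.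
apply: le_trans (leeD2l _ hs) _.
rewrite -/V -/E ge0_muleDr// ?V0//.
have -> : g x + (n%:R%:E * \int[mu]_(x0 in D) g x0 + n%:R%:E * V x +
    'C(n, 2)%:R%:E * E + n%:R%:E) = (g x + n%:R%:E * V x) +
    (n%:R%:E * \int[mu]_(x0 in D) g x0 + 'C(n, 2)%:R%:E * E + n%:R%:E).
  by rewrite !addeA; congr (_ + _ + _); rewrite -!addeA; congr (_ + _); rewrite addeC.
apply: le_trans (leeD2r _ hx) _.
rewrite binS bin1 natrD EFinD ge0_muleDl ?lee_fin ?ler0n//.
rewrite -natr1 EFinD ge0_muleDl ?lee_fin// mul1e.
rewrite le_eqVlt; apply/orP; left; apply/eqP.
by rewrite (AC (3*3) (4*1*(5*2)*(6*3)))/=.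
Qed.

End ProbabilityIntegrals.

(** * The logarithmic kernel *)

Section LogKernel.
Context (R : realType).
Local Open Scope ereal_scope.

Lemma measurable_lne_modC d (T : measurableType d) (f : T -> R) :
  measurable_fun setT f -> measurable_fun setT (fun x => lne (f x)%:E).
Proof.
move=> mf; rewrite [X in measurable_fun _ X](_ : _ =
    (fun x => if (f x <= 0)%R then -oo else (ln (f x))%:E))//.
apply: measurable_fun_ifT => //; first exact: measurable_fun_ler.
by apply/measurable_EFinP; apply: measurableT_comp => //; exact: measurable_ln.
Qed.

Lemma measurable_Re : measurable_fun setT (fun z : borelC R => complex.Re z : R).
Proof.
apply: (@measurable_lipschitz_borelC R (fun z => complex.Re z) 1%R) => // z w.
by rewrite mul1r -raddfB; exact: ler_Re_modC.
Qed.

Lemma measurable_Im : measurable_fun setT (fun z : borelC R => complex.Im z : R).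
Proof.
apply: (@measurable_lipschitz_borelC R (fun z => complex.Im z) 1%R) => // z w.
by rewrite mul1r -raddfB; exact: ler_Im_modC.
Qed.

Lemma modCE (z : R[i]) : modC z = Num.sqrt (complex.Re z ^+ 2 + complex.Im z ^+ 2).
Proof. by case: z. Qed.

(** The distance is measurable for the product of the two Borel algebras
    because it is a function of real and imaginary parts; this is what gives
    access to Tonelli's theorem for the logarithmic kernel. *)
Lemma measurable_dist_borelC :
  measurable_fun setT (fun zw : borelC R * borelC R => modC (zw.1 - zw.2)%R).
Proof.
under eq_fun do rewrite modCE !raddfB/=.
have mRe : measurable_fun setT (fun zw : borelC R * borelC R =>
    (complex.Re zw.1 - complex.Re zw.2)%R).
  apply: measurable_funB.
  - exact: (measurableT_comp measurable_Re measurable_fst).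
  - exact: (measurableT_comp measurable_Re measurable_snd).
have mIm : measurable_fun setT (fun zw : borelC R * borelC R =>
    (complex.Im zw.1 - complex.Im zw.2)%R).
  apply: measurable_funB.
  - exact: (measurableT_comp measurable_Im measurable_fst).
  - exact: (measurableT_comp measurable_Im measurable_snd).
have msqrt : measurable_fun setT (fun x : R => Num.sqrt x).
  exact: continuous_measurable_fun (@sqrt_continuous R).
apply: (measurableT_comp msqrt).
by apply: measurable_funD; exact: measurable_funX.
Qed.

(** The logarithmic kernel shifted and reversed, so that on a set of diameter
    at most [expR M] it is nonnegative and all integrals make sense. *)
Definition log_defect (M : R) (z w : borelC R) : \bar R :=
  M%:E - lne (modC (z - w)%R)%:E.

Lemma measurable_log_defect (M : R) :
  measurable_fun setT (fun zw : borelC R * borelC R => log_defect M zw.1 zw.2).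
Proof.
apply: emeasurable_funB => //.
exact: measurable_lne_modC measurable_dist_borelC.
Qed.

Lemma measurable_log_defect1 (M : R) (z : borelC R) :
  measurable_fun setT (log_defect M z).
Proof. exact: measurableT_comp (measurable_log_defect M) (pair1_measurable z). Qed.

Lemma log_defect_ge0 (M : R) (z w : R[i]) :
  (modC (z - w) <= expR M)%R -> 0 <= log_defect M z w.
Proof.
rewrite /log_defect /=; case: ifPn => [_ _|]; first by rewrite addey.
rewrite -ltNge => zw0 zwM; rewrite -EFinB lee_fin subr_ge0.
by rewrite -(expRK M) ler_ln// posrE expR_gt0.
Qed.

(** An identity also where the kernel is infinite, since [M] is finite. *)
Lemma lne_log_defect (M : R) (z w : R[i]) :
  lne (modC (z - w)%R)%:E = M%:E - log_defect M z w.
Proof.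
rewrite /log_defect; case: (lne _) => [r| |]//=.
by rewrite -!EFinB; congr EFin; lra.
Qed.

Variables (K : set (planeC R)) (M : R) (mu : probability (borelC R) R).
Hypothesis cK : compact K.
Hypothesis KM : forall z w, K z -> K w -> (modC (z - w) <= expR M)%R.
Hypothesis muK : mu K = 1.

Let mK : measurable (K : set (borelC R)).
Proof. exact: measurable_compact_borelC. Qed.

Local Notation V z := (\int[mu]_(w in (K : set (borelC R))) log_defect M z w).

(** Tonelli's theorem asks for a kernel that is nonnegative everywhere, hence
    the truncation at [0] and the cut-off outside [K], harmless on [K]. *)
Lemma measurable_log_defect_integral : measurable_fun (K : set (borelC R)) (fun z => V z).
Proof.
pose G (zw : borelC R * borelC R) :=
  if zw.2 \in K then maxe 0 (log_defect M zw.1 zw.2) else 0.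
have mG : measurable_fun setT G.
  apply: measurable_fun_ifT => //.
  - apply: (measurableT_comp (f := fun z : borelC R => z \in K)) => //.
    apply: (measurable_fun_bool true); rewrite setTI [X in measurable X](_ : _ = K)//.
    by apply/seteqP; split => z /=; [exact: set_mem|exact: mem_set].
  - by apply: measurable_maxe => //; exact: measurable_log_defect.
have G0 zw : 0 <= G zw by rewrite /G; case: ifP => // _; rewrite le_max lexx.
have := @measurable_fun_fubini_tonelli_F _ _ _ _ R mu G mG G0.
move=> /(measurable_funS measurableT (@subsetT _ (K : set (borelC R)))).
apply: eq_measurable_fun => z /set_mem Kz.
rewrite /fubini_F [RHS]integral_mkcond; apply: eq_integral => w _.
rewrite patchE /G /=; case: ifPn => // /set_mem Kw.
by apply/max_idPr; apply: log_defect_ge0; exact: KM.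
Qed.

Lemma log_potential_defect z : K z -> log_potential K mu z = M%:E - V z.
Proof.
move=> Kz; rewrite /log_potential.
under eq_integral do rewrite (lne_log_defect M).
rewrite integral_cstB//; first exact: measurable_funTS (measurable_log_defect1 M z).
by move=> w Kw; apply: log_defect_ge0; exact: KM.
Qed.

Lemma log_energy_defect :
  log_energy K mu = M%:E - \int[mu]_(z in (K : set (borelC R))) V z.
Proof.
rewrite /log_energy; under eq_integral => z /set_mem Kz do rewrite log_potential_defect//.
rewrite integral_cstB//; first exact: measurable_log_defect_integral.
move=> z Kz; apply: integral_ge0 => w Kw.
by apply: log_defect_ge0; exact: KM.
Qed.

End LogKernel.

(** * Vandermonde products *)

Section Vandermonde.

(** Monic polynomials of degrees [0, ..., n - 1] arise from the monomials by a
    unitriangular change of basis, which preserves determinants. *)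
Lemma det_monic_Vandermonde (F : comNzRingType) (n : nat) (q : 'I_n -> {poly F})
    (w : 'I_n -> F) :
  (forall i, q i \is monic) -> (forall i, size (q i) = i.+1) ->
  \det (\matrix_(i < n, j < n) (q i).[w j]) =
  \prod_(i < n) \prod_(j < n | (i < j)%N) (w j - w i).
Proof.
move=> qm qs.
pose C := \matrix_(i < n, k < n) (q i)`_k.
have -> : \matrix_(i < n, j < n) (q i).[w j] = C *m Vandermonde n (\row_j w j).
  apply/matrixP => i j; rewrite !mxE (@horner_coef_wide _ n) ?qs//.
  by apply: eq_bigr => k _; rewrite !mxE.
rewrite det_mulmx det_Vandermonde det_trig; last first.
  by apply/is_trig_mxP => i j ij; rewrite mxE nth_default// qs.
rewrite [X in X * _]big1 ?mul1r => [|i _]; last first.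
  by rewrite mxE; move/monicP: (qm i); rewrite lead_coefE qs.
by apply: eq_bigr => i _; apply: eq_bigr => j _; rewrite !mxE.
Qed.

Variable R : realType.

Lemma ler_modC_det (n : nat) (A : 'M[R[i]]_n) (b : 'I_n -> R) :
  (forall i j, modC (A i j) <= b i) -> modC (\det A) <= n`!%:R * \prod_i b i.
Proof.
move=> Ab; apply: le_trans (ler_modC_sum _ _ _) _.
rewrite -[X in _ <= X%:R * _]card_Sn mulr_natl -sumr_const /=.
rewrite (eq_bigl (mem 'S_n)) => [|s]; last by rewrite !inE.
apply: ler_sum => s _; rewrite modCM modC_prod.
have -> : modC ((-1) ^+ s : R[i]) = 1 by rewrite modCX modCN modC1 expr1n.
by rewrite mul1r; apply: ler_prod => i _; rewrite modC_ge0 Ab.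
Qed.

(** Evaluating the determinant in the basis [q ^ (i / m) * 'X ^ (i mod m)]
    turns a bound for [q] on a set into one for all Vandermonde products there. *)
Lemma Vandermonde_le (q : {poly R[i]}) (m n : nat) (S B : R) (w : 'I_n -> R[i]) :
  q \is monic -> size q = m.+1 -> (0 < m)%N -> 1 <= B ->
  (forall j, modC q.[w j] <= S) -> (forall j, modC (w j) <= B) ->
  \prod_(i < n) \prod_(j < n | (i < j)%N) modC (w j - w i) <=
  n`!%:R * \prod_(i < n) (S ^+ (i %/ m) * B ^+ m).
Proof.
move=> qm qs m0 B1 qS wB.
pose p (i : 'I_n) := q ^+ (i %/ m) * 'X^(i %% m).
have pm i : p i \is monic by rewrite monicMr ?monicXn// monic_exp.
have ps i : size (p i) = i.+1.
  rewrite size_monicM ?monic_exp ?monic_neq0 ?monicXn// size_polyXn addnS /=.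
  have := size_exp q (i %/ m); rewrite qs /= => h.
  rewrite -(prednK (_ : 0 < size (q ^+ (i %/ m)))%N); last first.
    by rewrite size_poly_gt0 monic_neq0// monic_exp.
  by rewrite h addSn mulnC -divn_eq.
have -> : \prod_(i < n) \prod_(j < n | (i < j)%N) modC (w j - w i) =
   modC (\det (\matrix_(i < n, j < n) (p i).[w j])).
  rewrite det_monic_Vandermonde// modC_prod.
  by apply: eq_bigr => i _; rewrite modC_prod.
apply: ler_modC_det => i j; rewrite mxE hornerM horner_exp hornerXn modCM !modCX.
apply: ler_pM; rewrite ?exprn_ge0 ?modC_ge0//.
  by rewrite lerXn2r ?nnegrE ?modC_ge0// (le_trans (modC_ge0 _) (qS j)).
apply: (@le_trans _ _ (B ^+ (i %% m))).
  by rewrite lerXn2r ?nnegrE ?modC_ge0// (le_trans _ B1).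
by rewrite ler_weXn2l// ltnW// ltn_pmod.
Qed.

Lemma lneM_ge0 (a b : R) : 0 <= a -> 0 <= b ->
  lne (a * b)%:E = (lne a%:E + lne b%:E)%E.
Proof.
rewrite le_eqVlt => /predU1P[<- _|a0]; first by rewrite mul0r /= lexx.
rewrite le_eqVlt => /predU1P[<-|b0].
  by rewrite mulr0 /= lexx leNgt a0.
by rewrite !lne_EFin ?mulr_gt0// lnM ?posrE// EFinD.
Qed.

Fixpoint dist_prod (s : seq R[i]) : R :=
  if s is x :: s' then \prod_(y <- s') modC (x - y) * dist_prod s' else 1.

Lemma dist_prod_ge0 s : 0 <= dist_prod s.
Proof.
elim: s => //= x s IH; rewrite mulr_ge0// prodr_ge0// => *; exact: modC_ge0.
Qed.

Lemma dist_prodE s : dist_prod s =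
  \prod_(i < size s) \prod_(j < size s | (i < j)%N) modC (s`_j - s`_i).
Proof.
elim: s => [|x s IH] /=; first by rewrite big_ord0.
rewrite [RHS]big_ord_recl [X in _ = X * _]big_mkcond.
rewrite [X in _ = X * _]big_ord_recl/= mul1r; congr (_ * _).
  by rewrite (big_nth 0) big_mkord; apply: eq_bigr => i _; rewrite modCB.
rewrite IH; apply: eq_bigr => i _.
rewrite [RHS]big_mkcond big_ord_recl/= mul1r big_mkcond/=.
by apply: eq_bigr => j _; rewrite /bump /= !add1n ltnS.
Qed.

Lemma sum_log_defect (M : R) (x : R[i]) (s : seq R[i]) :
  (\sum_(y <- s) log_defect M x y =
   ((size s)%:R * M)%:E - lne (\prod_(y <- s) modC (x - y))%:E)%E.
Proof.
elim: s => [|y s IH]; first by rewrite !big_nil mul0r lne1 sub0e oppe0.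
rewrite !big_cons IH /log_defect lneM_ge0 ?modC_ge0//; last first.
  by apply: prodr_ge0 => *; exact: modC_ge0.
rewrite -(natr1 (size s)) mulrDl mul1r.
rewrite /lne; do 2 case: ifP => _ //=; rewrite -!EFinD -?EFinN -?EFinD; congr EFin; lra.
Qed.

(** The energy of a configuration is, up to normalization, minus the logarithm
    of its Vandermonde product; a repeated point makes both sides [+oo]. *)
Lemma pair_log_defect (M : R) (s : seq (borelC R)) :
  pair_energy (log_defect M) s =
  (('C(size s, 2)%:R * M)%:E - lne (dist_prod s)%:E)%E.
Proof.
elim: s => [|x s IH]; rewrite [pair_energy _ _]/= [dist_prod _]/= [size _]/=.
  by rewrite bin_small// mul0r lne1 sub0e oppe0.
rewrite IH sum_log_defect lneM_ge0 ?dist_prod_ge0//; last first.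
  by apply: prodr_ge0 => *; exact: modC_ge0.
rewrite binS bin1 natrD mulrDl.
rewrite /lne; do 2 case: ifP => _ //=; rewrite -!EFinD -?EFinN -?EFinD; congr EFin; lra.
Qed.

End Vandermonde.

(** * Monic polynomials on a set of given capacity *)

Section Chebyshev.
Variable R : realType.
Implicit Types (K : set (planeC R)) (t a : R).

Lemma log_energy_le K t (mu : probability (borelC R) R) :
  0 < t -> capacity K = t%:E -> mu K = 1%E -> (log_energy K mu <= (ln t)%:E)%E.
Proof.
move=> t0 Kt muK; rewrite -lne_EFin// -Kt /capacity expeRK.
by apply: ereal_sup_ubound; exists mu.
Qed.

Lemma exists_large_log_energy K t a : 0 < t -> capacity K = t%:E -> a < ln t ->
  exists2 mu : probability (borelC R) R, mu K = 1%E & (a%:E < log_energy K mu)%E.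
Proof.
move=> t0 Kt; rewrite -lte_fin -lne_EFin// -Kt /capacity expeRK.
by move=> /ereal_sup_gt[_ [mu muK <-] amu]; exists mu.
Qed.

Lemma capacity_gt0_nonempty K t : 0 < t -> capacity K = t%:E -> K !=set0.
Proof.
move=> t0 Kt; have [|mu muK _] := @exists_large_log_energy K t (ln t - 1) t0 Kt.
  by rewrite ltrBlDr ltrDl.
apply/set0P/eqP => K0; move: muK; rewrite K0 measure0 => /esym/eqP.
by rewrite onee_eq0.
Qed.

Lemma compact_diam_bound K : compact K ->
  exists M, forall z w, K z -> K w -> modC (z - w) <= expR M.
Proof.
move=> /compact_planeC_bounded[B B1 KB]; exists (ln (B + B)) => z w Kz Kw.
rewrite lnK ?posrE; last by lra.
by rewrite (le_trans (ler_modCD _ _))// modCN lerD// KB.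
Qed.

(** A configuration of [n] points has [n (n - 1) / 2] pairs, and each pair
    contributes on average the energy of [mu]; the loss [n] is the accumulated
    slack of the successive choices. *)
Lemma exists_spread_points K a (mu : probability (borelC R) R) :
  compact K -> mu K = 1%E -> (a%:E < log_energy K mu)%E ->
  exists2 b, a < b & forall n, exists s : seq R[i],
    [/\ size s = n, (forall z, z \in s -> K z) &
        expR ('C(n, 2)%:R * b - n%:R) <= dist_prod s].
Proof.
move=> cK muK; have [M KM] := compact_diam_bound cK.
rewrite (log_energy_defect cK KM muK).
have mK : measurable (K : set (borelC R)) by exact: measurable_compact_borelC.
set E := (\int[mu]_(z in _) _)%E => aE.
have k0 z w : K z -> K w -> (0 <= log_defect M z w)%E.
  by move=> Kz Kw; apply: log_defect_ge0; exact: KM.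
have E0 : (0 <= E)%E by apply: integral_ge0 => z Kz; apply: integral_ge0 => w; exact: k0.
have [e Ee] : exists e, E = e%:E.
  by move: aE E0; case: E => [e _ _|//|//]; exists e.
exists (M - e); first by move: aE; rewrite Ee -EFinB lte_fin.
move=> n.
have [||||s [sn sK]] :=
    @exists_low_energy _ _ R mu _ mK muK (log_defect M) n (cst 0%E) k0.
- by move=> z _; apply: measurable_funTS; exact: measurable_log_defect1.
- exact: measurable_log_defect_integral.
- exact: measurable_cst.
- by [].
rewrite big1_eq add0e integral0 mule0 add0e -/E Ee pair_log_defect sn => H.
exists s; split => //.
move: H; have := dist_prod_ge0 s; rewrite le_eqVlt => /predU1P[<-|s0].
  by rewrite /= lexx.
rewrite lne_EFin// -EFinB -!EFinM -EFinD lee_fin => H.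
by rewrite -[leRHS]lnK ?posrE// ler_expR; lra.
Qed.

Lemma bin2_natr n : 'C(n, 2)%:R = n%:R * (n%:R - 1) / 2 :> R.
Proof.
elim: n => [|n IH]; first by rewrite mul0r mul0r.
by rewrite binS bin1 natrD IH -[n.+1%:R]natr1; lra.
Qed.

(** If [q] were smaller on [K], then by [Vandermonde_le] all Vandermonde
    products of [n] points of [K] would be at most [exp (a n^2 / 2 + O(n ln n))]
    with [a < ln t], against [exists_spread_points] for large [n]. *)
Lemma monic_sup_ge K t (q : {poly R[i]}) (m : nat) (S : R) :
  1 < t -> compact K -> capacity K = t%:E -> q \is monic -> size q = m.+1 ->
  (forall z, K z -> modC q.[z] <= S) -> t ^+ m <= S.
Proof.
move=> t1 cK Kt qm qs qS.
have t0 : 0 < t by lra.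
have lt0 : 0 < ln t by rewrite ln_gt0.
have [B B1 KB] := compact_planeC_bounded cK.
case: (posnP m) => [m0|m0].
  have [z Kz] := capacity_gt0_nonempty t0 Kt.
  apply: le_trans (qS z Kz); rewrite m0 expr0.
  move: qs; rewrite m0 => /eqP/size_poly1P[c c0 qc].
  by move/monicP: qm; rewrite qc lead_coefC => ->; rewrite hornerC modC1.
rewrite leNgt; apply/negP => St.
(* the growth rate of [S], made nonnegative so that [expR (m * a) ^+ (i %/ m)] is
   at most [expR (a * i)] in spite of the rounding *)
pose a := Num.max 0 (ln S / m%:R).
have m0R : 0 < m%:R :> R by rewrite ltr0n.
have S_le : S <= expR (m%:R * a).
  have [S0|S0] := leP S 0; first exact: le_trans S0 (expR_ge0 _).
  rewrite -[leLHS]lnK ?posrE// ler_expR mulrC -ler_pdivrMr//.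
  by rewrite /a le_max lexx orbT.
have a0 : 0 <= a by rewrite /a le_max lexx.
have alt : a < ln t.
  rewrite /a gt_max lt0/= ltr_pdivrMr// mulr_natr -lnXn//.
  have [S0|S0] := leP S 0; last by rewrite ltr_ln ?posrE ?exprn_gt0.
  by rewrite ln0// ln_gt0// exprn_egt1// -lt0n.
have [mu muK amu] := exists_large_log_energy t0 Kt alt.
have [b ab spread] := exists_spread_points cK muK amu.
have bnd n : 'C(n, 2)%:R * b - n%:R <=
    n%:R * ln n%:R + 'C(n, 2)%:R * a + n%:R * (m%:R * ln B).
  have [s [sn sK sd]] := spread n.
  rewrite -ler_expR; apply: le_trans sd _; rewrite dist_prodE; subst n.
  set n := size s.
  have sKi (j : 'I_n) : K s`_j by apply: sK; exact: mem_nth.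
  apply: le_trans (Vandermonde_le (S := expR (m%:R * a)) (B := B) qm qs m0 B1 _ _) _.
  - by move=> j; exact: le_trans (qS _ (sKi j)) S_le.
  - by move=> j; exact: KB.
  rewrite big_split/= prodr_const card_ord [leLHS]mulrA 2!expRD.
  have B0 : 0 < B by lra.
  have P0 : 0 <= \prod_(i < n) expR (m%:R * a) ^+ (i %/ m).
    by apply: prodr_ge0 => i _; rewrite exprn_ge0 ?expR_ge0.
  apply: ler_pM; [by rewrite mulr_ge0|by rewrite !exprn_ge0// ltW| |]; last first.
    by rewrite !expRM_natl lnK// -!exprM mulnC.
  apply: ler_pM => //.
  - rewrite expRM_natl; case: (posnP n) => [->|n0]; first by rewrite expr0.
    rewrite lnK ?posrE ?ltr0n// -natrX ler_nat.
    elim: (n) => // k IH; rewrite factS expnS leq_mul2l/=.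
    by apply: leq_trans IH _; case: k => // k; rewrite leq_exp2r.
  - rewrite -bin2_sum natr_sum big_mkord mulr_suml expR_sum.
    apply: ler_prod => i _; rewrite exprn_ge0 ?expR_ge0//= -expRM_natl ler_expR.
    by rewrite mulrA -natrM ler_wpM2r// ler_nat leq_divM.
have c0 : 0 <= m%:R * ln B by rewrite mulr_ge0 ?ln_ge0.
set c := m%:R * ln B in bnd c0.
(* along squares, [ln (k ^ 2)] is bounded by the linear term [2 k] *)
have sq (k : nat) : (0 < k)%N -> (k%:R ^+ 2 - 1) * (b - a) <= 2 + 2 * c + 4 * k%:R.
  move=> k0; have kR : 0 < k%:R :> R by rewrite ltr0n.
  have := bnd (k ^ 2)%N.
  rewrite bin2_natr natrX lnXn// => H.
  have lnk := ln_sublinear kR.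
  have k2 : 0 < k%:R ^+ 2 :> R by rewrite exprn_gt0.
  have : k%:R ^+ 2 * ((k%:R ^+ 2 - 1) / 2 * (b - a) - 1 - 2 * ln k%:R - c) <= 0 by lra.
  by rewrite pmulr_rle0//; lra.
(* large enough for the quadratic term to win *)
pose k := (Num.bound ((6 + 2 * c + (b - a)) / (b - a))).+1.
have d0 : 0 < b - a by lra.
have : 6 + 2 * c + (b - a) < k%:R * (b - a).
  rewrite -ltr_pdivrMr//; apply: lt_trans (archi_boundP _) _; last by rewrite ltr_nat.
  by rewrite divr_ge0//; lra.
have k1 : 1 <= k%:R :> R by rewrite ler1n.
have := sq k isT.
set x : R := k%:R in k1 *.
move=> h1 h2.
have : 0 < x * (x * (b - a) - (6 + 2 * c + (b - a))) by rewrite mulr_gt0; lra.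
have : 0 <= (x - 1) * (2 + 2 * c + (b - a)) by rewrite mulr_ge0; lra.
lra.
Qed.

End Chebyshev.

(** * Fekete polynomials *)

Section Fekete.

Lemma size_prod_XsubC_but1 (F : idomainType) (n : nat) (z : 'I_n -> F) (j : 'I_n) :
  size (\prod_(k < n | k != j) ('X - (z k)%:P)) = n.
Proof.
rewrite -big_filter size_prod_XsubC size_filter.
have := cardC1 j; rewrite card_ord cardE /enum_mem size_filter => cE.
rewrite (eq_count (a2 := mem (predC1 j)))// cE.
by rewrite prednK//; exact: leq_ltn_trans (ltn_ord j).
Qed.

(** Lagrange interpolation of the constant [1], valid at every [x]: the
    difference of both sides is a polynomial of degree less than [n] with [n]
    distinct roots. *)
Lemma lagrange_one (F : fieldType) (n : nat) (z : 'I_n -> F) (x : F) :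
  (0 < n)%N -> injective z ->
  \sum_(j < n) \prod_(k < n | k != j) ((x - z k) / (z j - z k)) = 1.
Proof.
move=> n0 zi.
pose P := \sum_(j < n) (\prod_(k < n | k != j) (z j - z k)^-1) *:
  \prod_(k < n | k != j) ('X - (z k)%:P) - 1.
have PE y : P.[y] = \sum_(j < n) \prod_(k < n | k != j) ((y - z k) / (z j - z k)) - 1.
  rewrite /P hornerD hornerN hornerC horner_sum; congr (_ - _).
  apply: eq_bigr => j _; rewrite hornerZ horner_prod -big_split/=.
  by apply: eq_bigr => k _; rewrite hornerXsubC mulrC.
suff P0 : P = 0 by apply/eqP; rewrite -subr_eq0 -PE P0 horner0.
apply/eqP; apply/negPn/negP => Pn0.
have sP : (size P <= n)%N.
  apply: leq_trans (size_polyD _ _) _; rewrite geq_max size_polyN size_poly1 n0 andbT.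
  apply: leq_trans (size_sum _ _ _) _; apply/bigmax_leqP => j _.
  apply: leq_trans (size_scale_leq _ _) _.
  by rewrite size_prod_XsubC_but1.
have := @max_poly_roots _ P [seq z j | j <- enum 'I_n] Pn0.
rewrite size_map size_enum_ord map_inj_uniq// enum_uniq => /(_ _ isT).
rewrite ltnNge sP => /(_ _)/notF; apply; apply/allP => _ /mapP[i _ ->].
rewrite rootE PE (bigD1 i)//= [X in X + _ - 1]big1 => [|k ki]; last first.
  by rewrite divff// subr_eq0 (inj_eq zi) eq_sym.
rewrite [X in 1 + X - 1]big1 ?addr0 ?subrr// => j ji.
by rewrite (bigD1 i)//= ?subrr ?mul0r// eq_sym.
Qed.

Variable R : realType.
Implicit Types (K : set (planeC R)) (t : R).

(** Off the discs of radius [n / D] around the zeros, each term of the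
    interpolation formula is smaller than [1 / n] in modulus. *)
Lemma lemniscate_near_roots (n : nat) (z : 'I_n -> R[i]) (D : R) (x : R[i]) :
  (0 < n)%N -> 0 < D ->
  (forall j, D <= \prod_(k < n | k != j) modC (z j - z k)) ->
  lemniscate (poly_of_roots z) x -> exists j, modC (x - z j) <= n%:R / D.
Proof.
move=> n0 D0 zD xL.
have zi : injective z.
  move=> j k jk; apply/eqP; apply/negPn/negP => njk.
  have := lt_le_trans D0 (zD j).
  by rewrite (bigD1 k) 1?eq_sym//= jk subrr modC0 mul0r ltxx.
apply: contrapT => nx.
have {}nx j : n%:R / D < modC (x - z j).
  by rewrite ltNge; apply/negP => ?; apply: nx; exists j.
have nR : 0 < n%:R :> R by rewrite ltr0n.
have := lagrange_one x n0 zi => /(congr1 (@modC R)); rewrite modC1 => s1.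
suff : (1 : R) < 1 by rewrite ltxx.
rewrite -[ltLHS]s1; apply: le_lt_trans (ler_modC_sum _ _ _) _.
apply: (@lt_le_trans _ _ (\sum_(j < n) n%:R^-1)); last first.
  by rewrite sumr_const card_ord -[leLHS]mulr_natr mulVf// gt_eqF.
apply: ltr_sum; first by apply/hasP; exists (Ordinal n0); rewrite ?mem_index_enum.
move=> j _.
have -> : modC (\prod_(k < n | k != j) ((x - z k) / (z j - z k))) =
   \prod_(k < n | k != j) modC (x - z k) / \prod_(k < n | k != j) modC (z j - z k).
  rewrite modC_prod -prodf_div; apply: eq_bigr => k kj.
  by rewrite modCM; congr (_ * _); exact: ComplexField.Normc.normcV.
have Dj := lt_le_trans D0 (zD j).
rewrite ltr_pdivrMr//; apply: lt_le_trans (_ : D / n%:R <= _); last first.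
  by rewrite mulrC ler_wpM2l// invr_ge0 ltW.
have xj0 : 0 < modC (x - z j) by apply: lt_trans (nx j); rewrite divr_gt0.
have : modC (x - z j) * \prod_(k < n | k != j) modC (x - z k) < 1.
  move: xL; rewrite /lemniscate/= /poly_of_roots horner_prod modC_prod.
  by rewrite (bigD1 j)//= hornerXsubC; under eq_bigr do rewrite hornerXsubC.
rewrite mulrC -ltr_pdivlMr// mul1r => /lt_trans; apply.
by rewrite -[ltRHS]invf_div ltf_pV2 ?posrE ?divr_gt0.
Qed.

Lemma powR_prod (I : Type) (r : seq I) (P : pred I) (f : I -> R) (a : R) :
  (forall i, P i -> 0 <= f i) ->
  \prod_(i <- r | P i) (f i `^ a) = (\prod_(i <- r | P i) f i) `^ a.
Proof.
move=> f0; elim: r => [|i r IH]; first by rewrite !big_nil powR1.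
rewrite !big_cons; case: ifP => // Pi; rewrite IH powRM ?f0//.
by apply: prodr_ge0 => k; exact: f0.
Qed.

(** Squaring the product over pairs makes all indices play the same role. *)
Lemma sqr_pair_prod (n : nat) (z : 'I_n -> R[i]) :
  (\prod_(j < n) \prod_(k < n | (j < k)%N) modC (z j - z k)) ^+ 2 =
  \prod_(j < n) \prod_(k < n | k != j) modC (z j - z k).
Proof.
rewrite expr2 {2}(exchange_big_dep xpredT)//= -big_split/=.
apply: eq_bigr => j _; rewrite [RHS](bigID (fun k : 'I_n => (j < k)%N))/=; congr (_ * _).
- apply: eq_bigl => k; rewrite -val_eqE/=; lia.
- by apply: eq_big => [k|k _]; [rewrite -val_eqE/=; lia|rewrite modCB].
Qed.

Lemma isolate_index_prod (n : nat) (z : 'I_n -> R[i]) (j0 : 'I_n) :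
  \prod_(j < n) \prod_(k < n | k != j) modC (z j - z k) =
  (\prod_(k < n | k != j0) modC (z j0 - z k)) ^+ 2 *
  \prod_(j < n | j != j0) \prod_(k < n | (k != j) && (k != j0)) modC (z j - z k).
Proof.
rewrite (bigD1 j0)//= expr2 -mulrA; congr (_ * _); rewrite -big_split/=.
apply: eq_bigr => j jj0; rewrite (bigD1 j0)//=; last by rewrite eq_sym.
by rewrite modCB.
Qed.

Lemma fekete_pair_prod_max (K : set R[i]) (n : nat) (z w : 'I_n -> R[i]) :
  (1 < n)%N -> fekete_tuple K z -> tuples_in K n w ->
  \prod_(j < n) \prod_(k < n | (j < k)%N) modC (w j - w k) <=
  \prod_(j < n) \prod_(k < n | (j < k)%N) modC (z j - z k).
Proof.
move=> n1 [_ zmax] wK.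
have pmE (v : 'I_n -> R[i]) : pairwise_mean v =
    (\prod_(j < n) \prod_(k < n | (j < k)%N) modC (v j - v k)) `^ (2 / (n * n.-1)%:R).
  rewrite /pairwise_mean -powR_prod => [|j _]; last first.
    by apply: prodr_ge0 => k _; exact: modC_ge0.
  by apply: eq_bigr => j _; rewrite powR_prod// => k _; exact: modC_ge0.
have a0 : 0 < 2 / (n * n.-1)%:R :> R.
  by rewrite divr_gt0// ltr0n muln_gt0; case: (n) n1 => [|[]].
have v0 (v : 'I_n -> R[i]) :
    0 <= \prod_(j < n) \prod_(k < n | (j < k)%N) modC (v j - v k).
  by apply: prodr_ge0 => j _; apply: prodr_ge0 => k _; exact: modC_ge0.
rewrite leNgt; apply/negP => zw.
have : ((pairwise_mean w)%:E <= (pairwise_mean z)%:E)%E.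
  by rewrite zmax; apply: ereal_sup_ubound; exists w.
by rewrite lee_fin leNgt !pmE gt0_ltr_powR ?nnegrE.
Qed.

(** The left product is the modulus at [z j] of the derivative of the Fekete
    polynomial. Moving [z j] within [K] cannot increase the Vandermonde product,
    so it is also the maximum over [K] of the monic polynomial with roots the
    other [z k], which [monic_sup_ge] bounds below. *)
Lemma fekete_derivative_ge K t (n : nat) (z : 'I_n -> R[i]) :
  1 < t -> compact K -> capacity K = t%:E -> fekete_tuple K z ->
  forall j, t ^+ n.-1 <= \prod_(k < n | k != j) modC (z j - z k).
Proof.
move=> t1 cK Kt zF j; have n0 : (0 < n)%N by case: (n) j => // -[].
have zK := zF.1.
have [n1|n1] := leqP n 1.
  have -> : n.-1 = 0%N by lia.
  rewrite big_pred0 ?expr0// => k; apply/negbTE; rewrite negbK -val_eqE/=.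
  by have := ltn_ord k; have := ltn_ord j; lia.
pose q := \prod_(k < n | k != j) ('X - (z k)%:P).
have t0 : 0 < t by lra.
apply: (@monic_sup_ge R K t q) => //.
- exact: monic_prod_XsubC.
- by rewrite size_prod_XsubC_but1 prednK.
move=> x Kx; rewrite horner_prod modC_prod; under eq_bigr do rewrite hornerXsubC.
have lt0 : 0 < ln t by rewrite ln_gt0.
have [mu muK mu0] := exists_large_log_energy t0 Kt lt0.
have [b _ spread] := exists_spread_points cK muK mu0.
have [s [sn sK sd]] := spread n.
(* cancelling the factors common to both tuples needs a nonzero product *)
have zpos : 0 < \prod_(j < n) \prod_(k < n | (j < k)%N) modC (z j - z k).
  apply: lt_le_trans (fekete_pair_prod_max n1 zF (_ : tuples_in K n (fun i => s`_i))).
    apply: lt_le_trans (expR_gt0 _) _; apply: le_trans sd _; rewrite dist_prodE sn.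
    apply: ler_prod => i _; rewrite prodr_ge0/= => [|k _]; rewrite ?modC_ge0//.
    by apply: ler_prod => k _; rewrite modC_ge0 modCB/=.
  by move=> i; apply: sK; rewrite mem_nth// sn.
pose w i := if i == j then x else z i.
have wK : tuples_in K n w by move=> i; rewrite /w; case: ifP => // _; exact: zK.
have := fekete_pair_prod_max n1 zF wK.
rewrite -ler_sqr ?nnegrE; last 2 first.
- by apply: prodr_ge0 => i _; apply: prodr_ge0 => k _; exact: modC_ge0.
- exact: ltW.
have rest0 : 0 < \prod_(i < n | i != j)
    \prod_(k < n | (k != i) && (k != j)) modC (z i - z k).
  have : 0 < (\prod_(j < n) \prod_(k < n | (j < k)%N) modC (z j - z k)) ^+ 2.
    by rewrite exprn_gt0.
  rewrite sqr_pair_prod (isolate_index_prod z j) => H; rewrite lt_neqAle eq_sym.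
  apply/andP; split; first by apply: contraTneq H => ->; rewrite mulr0 ltxx.
  by apply: prodr_ge0 => i _; apply: prodr_ge0 => k _; exact: modC_ge0.
rewrite !sqr_pair_prod !(isolate_index_prod _ j).
have -> : \prod_(i < n | i != j) \prod_(k < n | (k != i) && (k != j)) modC (w i - w k) =
    \prod_(i < n | i != j) \prod_(k < n | (k != i) && (k != j)) modC (z i - z k).
  apply: eq_bigr => i ij; apply: eq_bigr => k /andP[_ kj].
  by rewrite /w (negbTE ij) (negbTE kj).
have -> : \prod_(k < n | k != j) modC (w j - w k) = \prod_(k < n | k != j) modC (x - z k).
  by apply: eq_bigr => k kj; rewrite /w eqxx (negbTE kj).
by rewrite ler_pM2r// ler_sqr// nnegrE prodr_ge0// => k _; exact: modC_ge0.
Qed.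

End Fekete.

(** * Areas of lemniscates *)

Section Area.
Variable R : realType.

Local Notation leb2 := ((@lebesgue_measure R) \x (@lebesgue_measure R))%E.

Definition plane_set (A : set R[i]) : set (R * R) := [set xy | A (xy.1 +i* xy.2)%C].

Lemma measurable_poly_Re_Im (p : {poly R[i]}) :
  measurable_fun setT (fun xy : R * R => complex.Re p.[xy.1 +i* xy.2]%C) /\
  measurable_fun setT (fun xy : R * R => complex.Im p.[xy.1 +i* xy.2]%C).
Proof.
elim/poly_ind: p => [|p c [mRe mIm]].
  by split; under eq_fun do rewrite horner0; exact: measurable_cst.
have m1 : measurable_fun setT (fun xy : R * R => xy.1) by exact: measurable_fst.
have m2 : measurable_fun setT (fun xy : R * R => xy.2) by exact: measurable_snd.
split.
- rewrite [X in measurable_fun _ X](_ : _ = fun xy : R * R =>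
      complex.Re p.[xy.1 +i* xy.2]%C * xy.1 -
      complex.Im p.[xy.1 +i* xy.2]%C * xy.2 + complex.Re c).
    apply: measurable_funD => //; apply: measurable_funB; exact: measurable_funM.
  by apply/funext => xy; rewrite hornerMXaddC; case: (p.[_]) (c) => [a b] [e f].
- rewrite [X in measurable_fun _ X](_ : _ = fun xy : R * R =>
      complex.Re p.[xy.1 +i* xy.2]%C * xy.2 +
      complex.Im p.[xy.1 +i* xy.2]%C * xy.1 + complex.Im c).
    apply: measurable_funD => //; apply: measurable_funD; exact: measurable_funM.
  by apply/funext => xy; rewrite hornerMXaddC; case: (p.[_]) (c) => [a b] [e f].
Qed.

Lemma measurable_lemniscate (p : {poly R[i]}) :
  measurable (plane_set (lemniscate p)).
Proof.
have [mRe mIm] := measurable_poly_Re_Im p.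
pose g (xy : R * R) :=
  complex.Re p.[xy.1 +i* xy.2]%C ^+ 2 + complex.Im p.[xy.1 +i* xy.2]%C ^+ 2.
have mg : measurable_fun setT g by apply: measurable_funD; exact: measurable_funX.
have -> : plane_set (lemniscate p) = setT `&` g @^-1` `]-oo, 1%R[%classic.
  rewrite setTI; apply/seteqP.
  split => xy; rewrite /plane_set /lemniscate/= in_itv/= /g modCE.
  - by rewrite -[X in (_ < X)%R]sqrtr1 ltr_sqrt.
  - by rewrite -[X in _ -> (_ < X)%R]sqrtr1 ltr_sqrt.
exact: mg.
Qed.

Lemma leb2_square (a b r : R) : (0 <= r)%R ->
  leb2 (`[a - r, a + r]%classic `*` `[b - r, b + r]%classic) = ((2 * r) ^+ 2)%:E.
Proof.
move=> r0.
rewrite product_measure1E//= !lebesgue_measure_itv/= !lte_fin.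
have [->|rn0] := eqVneq r 0%R.
  by rewrite !subr0 !addr0 !ltxx mule0 mulr0 expr0n.
have rp : (0 < r)%R by rewrite lt_neqAle eq_sym rn0.
have lt2 (x : R) : x - r < x + r by lra.
rewrite !lt2 -!EFinB -EFinM; congr EFin.
have len2 (x : R) : x + r - (x - r) = 2 * r by lra.
by rewrite !len2 expr2.
Qed.

(** The disc is replaced by an inscribed square: constant factors in areas do
    not matter on the scale of [n]-th roots. *)
Lemma area_lemniscate_ge (p : {poly R[i]}) (c : R[i]) (r : R) : (0 < r)%R ->
  (forall z, (modC (z - c) < r)%R -> (modC p.[z] < 1)%R) ->
  (((r / 2) ^+ 2)%:E <= area (lemniscate p))%E.
Proof.
move=> r0 H; have -> : ((r / 2) ^+ 2 = (2 * (r / 4)) ^+ 2)%R by lra.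
rewrite -(@leb2_square (complex.Re c) (complex.Im c)); last by lra.
apply: le_measure; [by apply/mem_set; exact: measurableX|
  by apply/mem_set; exact: measurable_lemniscate|].
move=> [x y]/= []; rewrite !in_itv/= -!ler_distl => hx hy; apply: H.
apply: le_lt_trans (ler_modC_Re_Im _) _; rewrite !raddfB/=; lra.
Qed.

Lemma area_lemniscate_le (p : {poly R[i]}) (n : nat) (z : 'I_n -> R[i]) (r : R) :
  (0 <= r)%R ->
  (forall x, lemniscate p x -> exists j, (modC (x - z j) <= r)%R) ->
  (area (lemniscate p) <= (n%:R * (2 * r) ^+ 2)%:E)%E.
Proof.
move=> r0 H.
pose c i := if insub i is Some j then z j else 0.
pose Q i := `[complex.Re (c i) - r, complex.Re (c i) + r]%classic `*`
            `[complex.Im (c i) - r, complex.Im (c i) + r]%classic.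
have mQ j : measurable (Q j) by exact: measurableX.
apply: (@le_trans _ _ (leb2 (\big[setU/set0]_(i < n) Q i))).
  apply: le_measure; [by apply/mem_set; exact: measurable_lemniscate|
    by apply/mem_set; apply: bigsetU_measurable => *; exact: mQ|].
  move=> [x y]/= /H[j xj]; rewrite -bigcup_mkord; exists j => //=.
  rewrite /Q /c valK; split; rewrite /= in_itv/= -ler_distl.
  - by apply: le_trans xj; apply: le_trans (ler_Re_modC _); rewrite raddfB.
  - by apply: le_trans xj; apply: le_trans (ler_Im_modC _); rewrite raddfB.
have := @Boole_inequality _ R _ leb2 Q n (fun i _ => mQ i).
move=> /le_trans; apply.
apply: (@le_trans _ _ (\sum_(i < n) ((2 * r) ^+ 2)%:E)%E).
  apply: lee_sum => i _.
  rewrite -(@leb2_square (complex.Re (c i)) (complex.Im (c i)) r r0); exact: lexx.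
by rewrite sumEFin sumr_const card_ord -[_ *+ n]mulr_natl.
Qed.

End Area.

(** * Weak limits of finite sets of points *)

(** Words list the bits most recent first, so that a word is refined by adding
    a bit at its head. *)
Fixpoint word (T : Type) (b : nat -> T -> bool) (L : nat) (z : T) : seq bool :=
  if L is L'.+1 then b L' z :: word b L' z else [::].

Section Words.
Variables (T : Type) (b : nat -> T -> bool).

Lemma size_word L z : size (word b L z) = L.
Proof. by elim: L => //= L ->. Qed.

Lemma word_bits L z w : word b L z = word b L w ->
  forall i, (i < L)%N -> b i z = b i w.
Proof.
elim: L => // L IH /= [bL /IH{}IH] i; rewrite ltnS leq_eqVlt => /predU1P[->//|].
exact: IH.
Qed.

End Words.

Section MassTree.
Variable R : realType.
(* A finitely additive mass distribution on the tree of words. *)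
Variable m : seq bool -> R.
Hypothesis m_ge0 : forall s, 0 <= m s.
Hypothesis m_split : forall s, m s = m (false :: s) + m (true :: s).
Hypothesis m_total : m [::] = 1.

(** The words of length [L] cut [0, 1[ into consecutive intervals of lengths
    [m s], the intervals of longer words refining those of shorter ones. *)
Fixpoint left_end (s : seq bool) : R :=
  if s is c :: s' then left_end s' + (if c then m (false :: s') else 0) else 0.

(** The word whose interval contains [x], found by successive bisection. *)
Fixpoint word_at (x : R) (L : nat) : seq bool :=
  if L is L'.+1 then
    let s := word_at x L' in (left_end s + m (false :: s) <= x) :: s
  else [::].

Lemma size_word_at x L : size (word_at x L) = L.
Proof. by elim: L => //= L ->. Qed.

Lemma word_at_interval x L : 0 <= x < 1 ->
  left_end (word_at x L) <= x < left_end (word_at x L) + m (word_at x L).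
Proof.
move=> x01; elim: L => [|L IH] /=; first by rewrite m_total add0r.
set s := word_at x L in IH *; have := m_split s.
case: (leP (left_end s + m (false :: s)) x) => h ms; move: IH => /andP[? ?];
  by apply/andP; split; rewrite /= ?addr0; lra.
Qed.

Lemma word_at_mass_gt0 x L : 0 <= x < 1 -> 0 < m (word_at x L).
Proof. by move=> /word_at_interval - /(_ L) /andP[? ?]; lra. Qed.

Lemma interval_word_at x s : left_end s <= x < left_end s + m s ->
  word_at x (size s) = s.
Proof.
elim: s => //= c s IH; have := m_split s; have := m_ge0 (false :: s).
have := m_ge0 (true :: s); case: c => m1 m0 ms /andP[h1 h2].
- by rewrite IH ?h1//; lra.
- rewrite addr0 in h1 h2; rewrite IH; last by lra.
  by rewrite leNgt h2.
Qed.

Lemma left_end_bounds s : 0 <= left_end s /\ left_end s + m s <= 1.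
Proof.
elim: s => [|c s [h1 h2]] /=; first by rewrite m_total; lra.
have := m_split s; have := m_ge0 (false :: s); have := m_ge0 (true :: s).
by case: c => m1 m0 ms; lra.
Qed.

Lemma measurable_word_at (P : set (seq bool)) L :
  measurable [set x | P (word_at x L)].
Proof.
have m1 s : measurable [set x | word_at x (size s) = s].
  elim: s => [|c s IH] /=.
    by rewrite (_ : [set _ | _] = setT)//; apply/seteqP; split.
  rewrite (_ : [set _ | _] = [set x | word_at x (size s) = s] `&`
      (if c then `[left_end s + m (false :: s), +oo[%classic
       else `]-oo, left_end s + m (false :: s)[%classic)).
    by apply: measurableI => //; case: c; exact: measurable_itv.
  apply/seteqP; split => x /=.
  - move=> [h e]; rewrite e in h; split => //.
    by case: c h => h; rewrite /= in_itv/= ?andbT ?ltNge h.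
  - move=> [-> h]; congr (_ :: _); move: h.
    by case: c; rewrite /= in_itv/= ?andbT// ltNge => /negbTE.
rewrite (_ : [set _ | _] =
    \bigcup_s ([set x | word_at x (size s) = s] `&` [set _ | P s /\ size s = L])).
  apply: countable_bigcupT_measurable => // s; apply: measurableI => //.
  have [h|h] := pselect (P s /\ size s = L).
  - by rewrite (_ : mkset _ = setT)//; apply/seteqP; split => // x _; exact: h.
  - by rewrite (_ : mkset _ = set0)//; apply/seteqP; split => // x hx; exact: h hx.
apply/seteqP; split => x /=; last by move=> [s _ [e [Ps <-]]]; rewrite e.
by move=> Px; exists (word_at x L) => //=; rewrite ?size_word_at.
Qed.

End MassTree.

Section Ultralimits.
Variables (F : set_system nat) (FU : UltraFilter F).

(** Ultralimits make all limits of bounded data exist at once, which replaces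
    extracting subsequences by a diagonal argument. *)
Lemma ultra_compact_cvg (T : topologicalType) (A : set T) (u : nat -> T) :
  compact A -> (forall n, A (u n)) -> exists2 l, A l & u @ F --> l.
Proof.
move=> cA uA; have [|l [Al ul]] := cA (u @ F) _; first exact: (@filterE _ F _ _ uA).
exists l => // B Bl; have [//|nB] := in_ultra_setVsetC (u @^-1` B) FU.
by have [x [nBx /nBx]] := ul (~` B) B nB Bl.
Qed.

Lemma ultra_itv_cvg (R : realType) (a c : R) (u : nat -> R) :
  (forall n, a <= u n <= c) -> exists l : R, u @ F --> l.
Proof.
move=> ua; have [|l _ ul] := @ultra_compact_cvg R _ u (@segment_compact R a c).
  by move=> n; rewrite /= in_itv/= ua.
by exists l.
Qed.

End Ultralimits.

Lemma archi_inv_lt (R : realType) (e : R) :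
  0 < e -> (Num.bound (2 / e)).+1%:R^-1 < e / 2.
Proof.
move=> e0; rewrite -[ltRHS]invf_div ltf_pV2 ?posrE ?divr_gt0//.
apply: lt_trans (archi_boundP _) _; first by rewrite divr_ge0// ltW.
by rewrite ltr_nat.
Qed.

(** The bits record membership in the discs of finite nets of [K] of every
    mesh; two points with the same first bits lie in a common small disc. *)
Lemma exists_separating_bits (R : realType) (K : set (planeC R)) : compact K ->
  exists b : nat -> R[i] -> bool, forall e : R, 0 < e -> exists L,
    forall z w, K z -> K w -> word b L z = word b L w -> modC (z - w) < e.
Proof.
move=> cK.
have /choice[net netP] : forall k : nat, exists s : seq R[i],
    forall z, K z -> exists2 c, c \in s & modC (c - z) < k.+1%:R^-1.
  by move=> k; apply: compact_planeC_net => //; rewrite invr_gt0.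
pose b i z := if unpickle i is Some (k, j) then
  modC ((net k)`_j - z) < k.+1%:R^-1 else false.
exists b => e e0.
pose k := Num.bound (2 / e).
have ke : k.+1%:R^-1 < e / 2 := archi_inv_lt e0.
pose L := (\max_(j < size (net k)) pickle (k, nat_of_ord j)).+1.
exists L => z w Kz Kw zwL; have zw := word_bits zwL.
have [c cs cz] := netP k z Kz.
have jlt : (index c (net k) < size (net k))%N by rewrite index_mem.
have cw : modC (c - w) < k.+1%:R^-1.
  have := zw (pickle (k, index c (net k))); rewrite /b pickleK nth_index// cz => <- //.
  rewrite /L ltnS.
  pose code (j : 'I_(size (net k))) := pickle (k, nat_of_ord j).
  exact: (@leq_bigmax _ code (Ordinal jlt)).
have := ler_modC_dist z c w; rewrite (modCB z c).
by move: cz cw ke; set d := k.+1%:R^-1; lra.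
Qed.

Section WeakLimit.
Variables (R : realType) (K : set (planeC R)) (cK : compact K).
Variables (F : set_system nat) (FU : UltraFilter F).
Hypothesis F_tail : forall N, F [set n | (N <= n)%N].
Variable Z : nat -> nat -> R[i].
Hypothesis ZK : forall n j, K (Z n j).

(** Weak compactness of probability measures on [K], for uniform measures on
    finite sets of points. The limit measure is the image of the uniform law
    on [0, 1] by [phi]: the ultralimits of the proportions of points with given
    words form a mass distribution on the tree of words, its intervals code
    [0, 1[ by infinite words, and [phi] sends [x] to the point of [K] whose bits
    are those of the word of [x]. The third clause says that every value of
    [phi] is a limit of points of the sets, i.e., lies in the support of the
    limit; the last one is the half of weak convergence that is used. *)
Theorem exists_weak_limit : exists phi : R -> R[i],
  [/\ measurable_fun setT (phi : R -> borelC R), (forall x, K (phi x)),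
      (forall x r, 0 < r -> F [set n | exists2 j, (j < n)%N & modC (Z n j - phi x) < r]) &
      forall (g : R[i] -> R) (l c : R), 0 < l ->
        (forall z w, `|g z - g w| <= l * modC (z - w)) -> (forall z, 0 <= g z) ->
        F [set n | c <= n%:R^-1 * \sum_(j < n) g (Z n j)] ->
        (c%:E <= \int[uniform_prob (@ltr01 R)]_x (g (phi x))%:E)%E].
Proof.
have FP : ProperFilter F := @ultra_proper _ _ FU.
have FF : Filter F by exact: filter_filter.
have [b bP] := exists_separating_bits cK.
pose freq s n := n%:R^-1 * \sum_(j < n) (word b (size s) (Z n j) == s)%:R : R.
have freq01 s n : 0 <= freq s n <= 1.
  rewrite /freq mulr_ge0 ?invr_ge0//= ?sumr_ge0//.
  case: (posnP n) => [->|n0]; first by rewrite big_ord0 mulr0.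
  rewrite ler_pdivrMl ?ltr0n// mulr1; apply: (@le_trans _ _ (\sum_(j < n) 1)).
    by apply: ler_sum => j _; rewrite lern1 leq_b1.
  by rewrite sumr_const card_ord.
have /choice[m mlim] : forall s, exists l : R, freq s @ F --> l.
  by move=> s; apply: (ultra_itv_cvg FU (a := 0) (c := 1)).
have m0 s : 0 <= m s.
  by apply: cvgr_to_ge (mlim s) _; apply: filterE => n; have /andP[] := freq01 s n.
have ms s : m s = m (false :: s) + m (true :: s).
  have h : freq (false :: s) n + freq (true :: s) n @[n --> F] -->
      m (false :: s) + m (true :: s).
    by apply: cvgD; exact: mlim.
  suff e : freq s = freq (false :: s) \+ freq (true :: s).
    have ls := mlim s; rewrite e in ls.
    exact: (@cvg_unique _ (@Rhausdorff R) _ _ _ _ ls h).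
  apply/funext => n; rewrite /freq /= -mulrDr -big_split/=; congr (_ * _).
  apply: eq_bigr => j _; rewrite !eqseq_cons; case: (b _ _); rewrite /= ?addr0 ?add0r//.
have mt : m [::] = 1.
  apply: (cvg_unique (@Rhausdorff R) (mlim [::])); apply: cvg_near_cst.
  apply: filterS (F_tail 1) => n /= n1; rewrite /freq /=.
  by rewrite sumr_const card_ord mulVf// pnatr_eq0 -lt0n.
(* words that do not occur in [K] get an arbitrary point of [K]; they have no mass *)
have /choice[pt ptP] : forall s, exists y, K y /\
    forall z, K z -> word b (size s) z = s -> word b (size s) y = s.
  move=> s; have [[z Kz zs]|nz] := pselect (exists2 z, K z & word b (size s) z = s).
    by exists z.
  by exists (Z 0 0); split => // z Kz zs; case: nz; exists z.
have ptK s : K (pt s) by case: (ptP s).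
have mword s : 0 < m s -> F [set n | exists2 j, (j < n)%N & word b (size s) (Z n j) = s].
  move=> ms0; have := mlim s => /cvgr_gt/(_ _ ms0); apply: filterS => n /= fn.
  apply: contrapT => nj; move: fn; rewrite /freq big1 ?mulr0 ?ltxx// => j _.
  by apply/eqP; rewrite pnatr_eq0 eqb0; apply/eqP => ej; apply: nj; exists j.
have mpt s : 0 < m s -> word b (size s) (pt s) = s.
  move=> /mword/filter_ex[n [j _ zs]].
  by have [_ h] := ptP s; exact: h (ZK n j) zs.
(* only [0, 1[ carries mass; other reals are sent to [0] to keep [phi] total *)
pose cl (x : R) : R := if 0 <= x < 1 then x else 0.
have cl01 x : 0 <= cl x < 1 by rewrite /cl; case: ifP => //; rewrite lexx ltr01.
pose wd x L := word_at m (cl x) L.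
have wd0 x L : 0 < m (wd x L) by exact: word_at_mass_gt0.
have swd x L : size (wd x L) = L by exact: size_word_at.
have wdpt x L L' : (L <= L')%N -> word b L (pt (wd x L')) = wd x L.
  move=> LL'; have := mpt _ (wd0 x L'); rewrite swd; move: LL'.
  move: (pt _) => y; rewrite /wd; elim: L' => [|L' IH].
    by rewrite leqn0 => /eqP ->.
  by rewrite leq_eqVlt ltnS => /predU1P[->//|LL'] [_ /IH]; apply.
have /choice[phi phiP] : forall x, exists y : planeC R,
    K y /\ (fun L => pt (wd x L) : planeC R) @ F --> y.
  move=> x; have [|y Ky yl] :=
      @ultra_compact_cvg F FU (planeC R) K (fun L => pt (wd x L)) cK.
    by move=> L; exact: ptK.
  by exists y.
(* [phi] is approximated by finitely valued functions, uniformly in [x] *)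
have phi_near e L x :
    (forall z w, K z -> K w -> word b L z = word b L w -> modC (z - w) < e) ->
    modC (phi x - pt (wd x L)) <= e.
  move=> Le; rewrite leNgt; apply/negP => h; have [_ xl] := phiP x.
  pose U : set (planeC R) :=
    [set y | modC (phi x - y) < modC (phi x - pt (wd x L)) - e].
  have : nbhs (phi x) U.
    apply/nbhs_planeC; exists (modC (phi x - pt (wd x L)) - e) => //.
    by rewrite subr_gt0.
  move=> /xl xlU; have [L' [/= LL' U']] := filter_ex (@filterI _ F _ _ _ (F_tail L) xlU).
  have h' : modC (phi x - pt (wd x L')) < modC (phi x - pt (wd x L)) - e := U'.
  have := Le (pt (wd x L')) (pt (wd x L)) (ptK _) (ptK _).
  rewrite !wdpt// => /(_ erefl).
  by have := ler_modC_dist (phi x) (pt (wd x L')) (pt (wd x L)); lra.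
have mcl : measurable_fun setT cl.
  apply: measurable_fun_ifT => //.
  by apply: measurable_and; [exact: measurable_fun_ler|exact: measurable_fun_ltr].
have mwd (P : set (seq bool)) L : measurable [set x | P (wd x L)].
  have := mcl measurableT _ (measurable_word_at m P L).
  by rewrite setTI.
have K_phi x : K (phi x) by case: (phiP x).
have mphi : measurable_fun setT (phi : R -> borelC R).
  have /choice[Ls LsP] : forall k : nat, exists L, forall z w, K z -> K w ->
      word b L z = word b L w -> modC (z - w) < k.+1%:R^-1.
    by move=> k; apply: bP; rewrite invr_gt0.
  apply: (@measurability _ _ _ (borelC R) setT phi (@open (planeC R))) => // _ [G oG <-].
  rewrite setTI.
  (* at mesh [1 / (k + 1)], all possible positions of [phi x] lie in [G] *)
  pose inside k : set (seq bool) :=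
    fun s => forall w, modC (w - pt s) <= k.+1%:R^-1 -> G w.
  rewrite (_ : _ @^-1` _ = \bigcup_k [set x | inside k (wd x (Ls k))]).
    by apply: bigcupT_measurable => k; exact: mwd.
  apply/seteqP; split => x /=.
  - move=> Gx; have /open_planeC/(_ _ Gx)[r r0 rG] := oG.
    pose k := Num.bound (2 / r); exists k => // w wp; apply: rG.
    have ke : k.+1%:R^-1 < r / 2 := archi_inv_lt r0.
    have hn := phi_near _ _ x (LsP k).
    have ht := ler_modC_dist (phi x) (pt (wd x (Ls k))) w.
    by move: wp hn ht ke; rewrite (modCB w); set d := k.+1%:R^-1; lra.
  - by move=> [k _ kG]; apply: kG; apply: phi_near; exact: LsP.
exists phi; split => //.
- move=> x r r0; have [|L LP] := bP (r / 2); first by lra.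
  apply: filterS (mword _ (wd0 x L)) => n [j jn]; rewrite swd => e; exists j => //.
  have := LP (Z n j) (pt (wd x L)) (ZK _ _) (ptK _); rewrite e wdpt// => /(_ erefl).
  have := phi_near _ _ x LP; rewrite (modCB (phi x)).
  by have := ler_modC_dist (Z n j) (pt (wd x L)) (phi x); lra.
move=> g l c l0 gl g0 gc.
have gphi0 x : (0 <= (g (phi x))%:E)%E by rewrite lee_fin.
have mgphi : measurable_fun setT (fun x => (g (phi x))%:E).
  apply/measurable_EFinP.
  exact: (measurableT_comp (measurable_lipschitz_borelC l0 gl) mphi).
apply/lee_addgt0Pr => e e0.
have e2l : 0 < e / 2 / l by rewrite !divr_gt0.
have [L LP] := bP _ e2l.
(* A step function below [g \o phi]; at the points of the sets its value is
   also at least [g - e], so it compares the integral with the averages. *)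
pose h s := Num.max 0 (g (pt s) - e / 2).
have h0 s : 0 <= h s by rewrite /h le_max lexx.
have g_lip z w r : modC (z - w) <= r / l -> g w - r <= g z.
  move=> zw; have := gl z w; rewrite ler_distl => /andP[+ _].
  have : l * modC (z - w) <= r by rewrite mulrC -ler_pdivlMr.
  lra.
have h_word z : K z -> g z - e <= h (word b L z).
  move=> Kz; rewrite /h le_max; apply/orP; right.
  have [_ /(_ z Kz)] := ptP (word b L z); rewrite size_word => /(_ erefl) pz.
  have := g_lip (pt (word b L z)) z (e / 2) (ltW (LP _ _ (ptK _) Kz pz)).
  lra.
have h_phi x : h (wd x L) <= g (phi x).
  rewrite /h ge_max g0 /=; apply: g_lip; exact: phi_near.
pose S := \sum_(s : L.-tuple bool) h s * m s.
have cS : c - e <= S.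
  have lim : (fun n => \sum_(s : L.-tuple bool) h s * freq s n) @ F --> S.
    by apply: cvg_big => [|s _]; [exact: add_continuous|apply: cvgMl_tmp; exact: mlim].
  apply: cvgr_to_ge lim _; apply: filterS (filterI gc (F_tail 1)) => n /= [cn n1].
  have nR : 0 < n%:R :> R by rewrite ltr0n.
  have -> : \sum_(s : L.-tuple bool) h s * freq s n =
      n%:R^-1 * \sum_(j < n) h (word b L (Z n j)).
    rewrite /freq; under eq_bigr => s _ do rewrite mulrCA mulr_sumr.
    rewrite -mulr_sumr exchange_big/=; congr (_ * _); apply: eq_bigr => j _.
    have sz : size (word b L (Z n j)) == L by rewrite size_word.
    rewrite (bigD1 (Tuple sz))//= size_word eqxx mulr1 big1 ?addr0// => s sj.
    rewrite size_tuple (_ : _ == _ = false) ?mulr0//.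
    by apply/negbTE; apply: contra sj => /eqP ej; apply/eqP/val_inj; rewrite /= ej.
  apply: (@le_trans _ _ (n%:R^-1 * \sum_(j < n) (g (Z n j) - e))).
    rewrite sumrB sumr_const card_ord mulrBr -[e *+ n]mulr_natl mulKf ?gt_eqF//.
    by rewrite lerB.
  rewrite ler_pM2l ?invr_gt0//; apply: ler_sum => j _; exact: h_word.
pose I s : set R := `[left_end m s, left_end m s + m s[%classic.
have sum_le x : \sum_(s : L.-tuple bool) h s * \1_(I s) x <= g (phi x).
  have [[s Ix]|nI] := pselect (exists s : L.-tuple bool, I s x); last first.
    rewrite big1// => s _; rewrite indicE memNset ?mulr0// => Ix.
    by apply: nI; exists s.
  have IE (s' : L.-tuple bool) : I s' x -> wd x L = s'.
    rewrite /I/= in_itv/= => Ix'; have [l1 l2] := left_end_bounds m0 ms mt s'.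
    rewrite /wd /cl ifT; last by move: Ix' => /andP[? ?]; apply/andP; split; lra.
    by rewrite -{1}(size_tuple s'); exact: interval_word_at.
  rewrite (bigD1 s)//= big1 ?addr0 => [|s' ss'].
    by rewrite indicE mem_set// mulr1 -(IE s Ix).
  rewrite indicE memNset ?mulr0// => /IE e1; move: ss'.
  by rewrite -val_eqE/= -e1 -(IE s Ix) eqxx.
suff : (S%:E <= \int[uniform_prob (@ltr01 R)]_x (g (phi x))%:E)%E.
  move=> Sle; rewrite -leeBlDr// -EFinB; apply: le_trans Sle.
  by rewrite lee_fin.
rewrite integral_uniform// subr0 invr1 mul1e.
have hI0 s x : (0 <= (h s)%:E * (\1_(I s) x)%:E)%E by rewrite -EFinM lee_fin mulr_ge0.
have mI s : measurable (I s) by exact: measurable_itv.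
have m1I s D : measurable_fun D (fun x => (\1_(I s) x)%:E : \bar R).
  by apply/measurable_EFinP; exact: measurable_indic.
have mhI s D : measurable_fun D (fun x => ((h s)%:E * (\1_(I s) x)%:E)%E).
  exact: measurable_funeM.
apply: (@le_trans _ _ (\int[lebesgue_measure]_(x in `[0%R, 1%R])
    \sum_(s : L.-tuple bool) (h s)%:E * (\1_(I s) x)%:E)%E); last first.
  apply: ge0_le_integral => //.
  - by move=> x _; apply: sume_ge0.
  - by apply: emeasurable_sum => s; exact: mhI.
  - exact: measurable_funTS.
  - move=> x _; under eq_bigr do rewrite -EFinM.
    by rewrite sumEFin lee_fin.
rewrite ge0_integral_sum//; last by move=> s; exact: mhI.
rewrite /S -sumEFin; apply: lee_sum => s _.
rewrite (_ : integral _ _ _ = ((h s)%:E *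
    \int[lebesgue_measure]_(x in `[0%R, 1%R]) (\1_(I s) x)%:E)%E); last first.
  apply: ge0_integralZl => //; rewrite ?lee_fin//.
  exact: m1I.
have Isub : I s `<=` `[0%R, 1%R]%classic.
  move=> x; rewrite /I/= !in_itv/= => /andP[? ?].
  by have [l1 l2] := left_end_bounds m0 ms mt s; apply/andP; split; lra.
have lI : lebesgue_measure (I s) = (m s)%:E.
  rewrite /I lebesgue_measure_itv/= lte_fin.
  have := m0 s; rewrite le_eqVlt => /predU1P[<-|ms0]; first by rewrite addr0 ltxx.
  by rewrite ltrDl ms0 -EFinB; congr EFin; lra.
rewrite EFinM; apply: lee_wpmul2l; first by rewrite lee_fin.
rewrite integral_indic//; last exact: mI.
by rewrite (setIidl Isub) -lI; exact: lexx.
Qed.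

End WeakLimit.

(** * Lower bound for the area of lemniscates *)

Section LowerBound.
Variable R : realType.

(** Unlike the logarithm, its truncation at [ln c] is Lipschitz on the whole
    line, hence can be integrated against weak limits. *)
Definition trunc_ln (c r : R) : R := ln (Num.max r c).

Lemma trunc_ln_ge c r : 0 < c -> ln c <= trunc_ln c r.
Proof. by move=> c0; rewrite ler_ln ?posrE ?lt_max ?c0 ?orbT// le_max lexx orbT. Qed.

Lemma le_expR_trunc_ln c r : 0 < c -> r <= expR (trunc_ln c r).
Proof. by move=> c0; rewrite lnK ?posrE ?lt_max ?c0 ?orbT// le_max lexx. Qed.

Lemma trunc_ln_lipschitz c r s : 0 < c ->
  `|trunc_ln c r - trunc_ln c s| <= c^-1 * `|r - s|.
Proof.
move=> c0.
have aux x y : trunc_ln c x - trunc_ln c y <= c^-1 * `|x - y|.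
  rewrite /trunc_ln; set X := Num.max x c; set Y := Num.max y c.
  have Yc : c <= Y by rewrite le_max lexx orbT.
  have X0 : 0 < X by rewrite lt_max c0 orbT.
  have Y0 : 0 < Y by exact: lt_le_trans Yc.
  have XY : X - Y <= `|x - y|.
    have xX : x <= Y + `|x - y|.
      have : y <= Y by rewrite le_max lexx.
      by have := ler_norm (x - y); lra.
    have cX : c <= Y + `|x - y| by have := normr_ge0 (x - y); lra.
    have : X <= Y + `|x - y| by rewrite ge_max xX cX.
    by lra.
  rewrite -ln_div ?posrE//.
  have -> : X / Y = 1 + (X - Y) / Y by field; rewrite gt_eqF.
  apply: le_trans (le_ln1Dx _) _.
    by rewrite ltr_pdivlMr//; lra.
  rewrite ler_pdivrMr//; apply: le_trans XY _.
  rewrite mulrC mulrA ler_peMl//.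
  by rewrite ler_pdivlMr// mul1r.
rewrite ler_norml aux andbT lerNl opprB.
by rewrite distrC aux.
Qed.

Lemma measurable_trunc_ln_dist (c : R) (z : R[i]) : 0 < c ->
  measurable_fun setT (fun w : borelC R => trunc_ln c (modC (z - w))).
Proof.
move=> c0.
pose f w := trunc_ln c (modC (z - w)).
apply: (@measurable_lipschitz_borelC R f c^-1) => [|v w].
  by rewrite invr_gt0.
apply: le_trans (trunc_ln_lipschitz _ _ c0) _.
rewrite ler_pM2l ?invr_gt0//; apply: le_trans (ler_dist_modC _ _) _.
by rewrite opprB addrC addrA subrK modCB.
Qed.

Lemma cvg_trunc_ln (M r : R) : 0 <= r ->
  (M - trunc_ln (n.+1%:R^-1) r)%:E @[n --> \oo] --> (M%:E - lne r%:E)%E.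
Proof.
rewrite le_eqVlt => /predU1P[<-|r0].
  rewrite [lne _](_ : _ = -oo%E); last by rewrite /= lexx.
  rewrite addey//; apply/cvgeryP/cvgryPge => A.
  exists (Num.bound (expR (A - M))) => // n /= An.
  rewrite /trunc_ln max_r ?invr_ge0// lnV ?posrE// opprK -lerBlDl.
  rewrite -[leLHS]expRK ler_ln ?posrE ?expR_gt0//.
  apply: le_trans (ltW (archi_boundP (expR_ge0 _))) _.
  by rewrite ler_nat ltnW.
rewrite lne_EFin// -EFinB; apply: cvg_near_cst.
exists (Num.bound r^-1) => // n /= rn; rewrite /trunc_ln max_l//.
rewrite -[leRHS]invrK lef_pV2 ?posrE ?invr_gt0//.
apply: le_trans (ltW (archi_boundP _)) _; first by rewrite invr_ge0 ltW.
by rewrite ler_nat ltnW.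
Qed.

Local Notation P := (uniform_prob (@ltr01 R)).

(** The truncated potentials decrease to the logarithmic potential, so a lower
    bound uniform in the truncation level [c] passes to the energy of the image
    measure. The kernel is shifted by [ln c] to be nonnegative. *)
Lemma log_energy_pushforward_ge (K : set (planeC R)) (phi : R -> R[i]) (a : R) :
  compact K -> measurable_fun setT (phi : R -> borelC R) -> (forall x, K (phi x)) ->
  (forall x c, 0 < c ->
     ((a - ln c)%:E <= \int[P]_y (trunc_ln c (modC (phi x - phi y)) - ln c)%:E)%E) ->
  exists2 mu : probability (borelC R) R, mu K = 1%E & (a%:E <= log_energy K mu)%E.
Proof.
move=> cK mphi Kphi aP.
have mK : measurable (K : set (borelC R)) by exact: measurable_compact_borelC.
have phiK : phi @^-1` K = setT by apply/seteqP; split => // x _; exact: Kphi.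
have mphi' : measurable_fun setT (phi : measurableTypeR R -> borelC R) by exact: mphi.
pose phi_mix := isMeasurableFun.Build _ _ (measurableTypeR R) (borelC R) phi mphi'.
pose phi_mfun : {mfun measurableTypeR R >-> borelC R} := HB.pack phi phi_mix.
pose mu : probability (borelC R) R := distribution P phi_mfun.
have muK : mu K = 1%E.
  by rewrite /mu /= /distribution /pushforward /= phiK probability_setT.
exists mu => //.
have [M0 KM0] := compact_diam_bound cK.
(* [1 <= expR M] leaves room for truncations at any [c <= 1] *)
pose M := Num.max M0 0.
have KM z w : K z -> K w -> modC (z - w) <= expR M.
  move=> Kz Kw; apply: le_trans (KM0 z w Kz Kw) _.
  by rewrite ler_expR le_max lexx.
have M1 : 1 <= expR M by rewrite -expR0 ler_expR le_max lexx orbT.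
rewrite (log_energy_defect cK KM muK).
have push (f : borelC R -> \bar R) : measurable_fun (K : set (borelC R)) f ->
    (forall z, K z -> 0 <= f z)%E ->
    (\int[mu]_(z in (K : set (borelC R))) f z = \int[P]_x f (phi x))%E.
  move=> mf f0; have := ge0_integral_pushforward mphi' P mK mf.
  by rewrite phiK; apply => z /set_mem; exact: f0.
have D0 z w : K z -> K w -> (0 <= log_defect M z w)%E.
  by move=> Kz Kw; apply: log_defect_ge0; exact: KM.
have potential x :
    (\int[mu]_(w in (K : set (borelC R))) log_defect M (phi x) w <= (M - a)%:E)%E.
  rewrite push; last 2 first.
  - exact: measurable_funTS (measurable_log_defect1 M (phi x)).
  - by move=> w; exact: D0.
  pose g k y := (M - trunc_ln (k.+1%:R^-1) (modC (phi x - phi y)))%:E.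
  have mt c : 0 < c -> measurable_fun setT (fun y => trunc_ln c (modC (phi x - phi y))).
    by move=> c0; exact: (measurableT_comp (measurable_trunc_ln_dist (phi x) c0) mphi).
  have mg k : measurable_fun setT (g k).
    by apply/measurable_EFinP; apply: measurable_funB => //; exact: mt.
  have g0 k y : setT y -> (0 <= g k y)%E.
    move=> _; rewrite lee_fin subr_ge0 -(expRK M).
    rewrite ler_ln ?posrE ?expR_gt0 ?lt_max ?invr_gt0 ?ltr0n ?orbT//.
    rewrite ge_max KM//=; apply: le_trans M1; rewrite invf_le1 ?ltr0n// ler1n//.
  have ndg y : setT y -> {homo g^~ y : n m / (n <= m)%N >-> (n <= m)%E}.
    move=> _ k j kj; rewrite lee_fin lerD2l lerN2.
    rewrite ler_ln ?posrE ?lt_max ?invr_gt0 ?ltr0n ?orbT//.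
    rewrite ge_max !le_max lexx/= lef_pV2 ?posrE ?ltr0n// ler_nat ltnS kj orbT//.
  have cv := @cvg_monotone_convergence _ _ R P setT measurableT g mg g0 ndg.
  have -> : (\int[P]_y log_defect M (phi x) (phi y) =
      \int[P]_y (fun y => limn (g^~ y)) y)%E.
    apply: eq_integral => y _; apply/esym/cvg_lim => //.
    by apply: cvg_trunc_ln; exact: modC_ge0.
  apply: cvge_to_le cv _; apply: nearW => k /=.
  set c : R := k.+1%:R^-1; have c0 : 0 < c by rewrite invr_gt0.
  have I2 := aP x c c0.
  have sumI : (\int[P]_y g k y + \int[P]_y (trunc_ln c (modC (phi x - phi y)) - ln c)%:E =
      (M - ln c)%:E)%E.
    rewrite -ge0_integralD//; last 4 first.
    - by move=> y _; exact: g0.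
    - exact: mg.
    - by move=> y _; rewrite lee_fin subr_ge0; exact: trunc_ln_ge.
    - by apply/measurable_EFinP; apply: measurable_funB => //; exact: mt.
    rewrite -[RHS](integral_cst_probability (mu := P) measurableT (probability_setT P)).
    by apply: eq_integral => y _; rewrite /g -/c -EFinD; congr EFin; lra.
  have := leeD2l (\int[P]_y g k y)%E I2.
  rewrite sumI -leeBrDr// -EFinB => /le_trans; apply.
  by rewrite lee_fin; lra.
rewrite push; last 2 first.
- exact: measurable_log_defect_integral.
- by move=> z Kz; apply: integral_ge0 => w; exact: D0.
set V := (\int[P]_x _)%E.
have : (V <= (M - a)%:E)%E.
  rewrite -[leRHS](integral_cst_probability (mu := P) measurableT (probability_setT P)).
  apply: ge0_le_integral => //.
  - by move=> x _; apply: integral_ge0 => w; exact: D0.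
  - have phiTK : phi @` setT `<=` K by move=> _ [x _ <-]; exact: Kphi.
    exact: (measurable_comp mK phiTK (measurable_log_defect_integral mu cK KM) mphi').
case: V => [v| |]//=; rewrite ?lee_fin; last by rewrite leey.
by lra.
Qed.

End LowerBound.

Section AreaLowerBound.
Variable R : realType.
Implicit Types (K : set (planeC R)) (t : R).

(** By the Lipschitz property the truncated mean is at most [a + d] in a disc
    around [x] of radius independent of [n]. Dropping the factor of the root
    [z j], the others have product at most [exp (n (a + d)) / c] there, so the
    polynomial is less than [1] within [c exp (- n (a + d))] of [z j]. *)
Lemma area_ge_of_truncated_mean (n : nat) (z : 'I_n -> R[i]) (x : R[i]) (j : 'I_n)
    (a c d : R) :
  0 < c -> 0 < d ->
  n%:R^-1 * \sum_(k < n) trunc_ln c (modC (x - z k)) <= a ->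
  modC (z j - x) < c * d / 2 ->
  expR (ln c - n%:R * (a + d)) <= c * d / 2 ->
  (((expR (ln c - n%:R * (a + d)) / 2) ^+ 2)%:E <= area (lemniscate (poly_of_roots z)))%E.
Proof.
move=> c0 d0 avg zx rle; have n0 : (0 < n)%N by exact: leq_ltn_trans (ltn_ord j).
have nR : 0 < n%:R :> R by rewrite ltr0n.
apply: (area_lemniscate_ge (c := z j)); first exact: expR_gt0.
move=> w wz; rewrite /poly_of_roots horner_prod modC_prod.
under eq_bigr do rewrite hornerXsubC.
have wx : modC (w - x) <= c * d.
  by have := ler_modC_dist w (z j) x; lra.
have lip k : trunc_ln c (modC (w - z k)) <= trunc_ln c (modC (x - z k)) + d.
  have := trunc_ln_lipschitz (modC (w - z k)) (modC (x - z k)) c0.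
  rewrite ler_distl => /andP[_ /le_trans]; apply; rewrite lerD2l.
  rewrite mulrC ler_pdivrMr// mulrC; apply: le_trans (ler_dist_modC _ _) _.
  by rewrite opprB addrA subrK.
have sum_le : \sum_(k < n) trunc_ln c (modC (w - z k)) <= n%:R * (a + d).
  apply: (@le_trans _ _ (\sum_(k < n) (trunc_ln c (modC (x - z k)) + d))).
    by apply: ler_sum => k _; exact: lip.
  rewrite big_split/= sumr_const card_ord -[d *+ n]mulr_natl mulrDr lerD2r.
  by rewrite -ler_pdivrMl.
rewrite (bigD1 j)//=.
have prod_le : \prod_(k < n | k != j) modC (w - z k) <= expR (n%:R * (a + d) - ln c).
  apply: (@le_trans _ _ (expR (\sum_(k < n | k != j) trunc_ln c (modC (w - z k))))).
    rewrite expR_sum; apply: ler_prod => k _.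
    by rewrite modC_ge0/=; exact: le_expR_trunc_ln.
  rewrite ler_expR; move: sum_le; rewrite (bigD1 j)//=.
  by have := trunc_ln_ge (modC (w - z j)) c0; lra.
apply: (@le_lt_trans _ _ (modC (w - z j) * expR (n%:R * (a + d) - ln c))).
  by rewrite ler_wpM2l// modC_ge0.
by rewrite -ltr_pdivlMr ?expR_gt0// mul1r -expRN opprB.
Qed.

(** Otherwise let [phi] describe a weak limit of the root counting measures of
    polynomials with too small lemniscates. If a truncated potential of the limit
    were less than [ln t + e / 2] at some [phi x], so would be the truncated
    logarithmic means of the roots, and [area_ge_of_truncated_mean] at a root
    near [phi x] would give a large lemniscate. So all truncated potentials are
    at least that large there, and the energy exceeds its maximal value [ln t]. *)
Theorem area_lemniscate_eventually_ge K t (e : R) :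
  1 < t -> compact K -> capacity K = t%:E -> 0 < e ->
  exists N, forall n (z : 'I_n -> R[i]), (N <= n)%N -> tuples_in K n z ->
    ((expR (- n%:R * (2 * (ln t + e))))%:E <= area (lemniscate (poly_of_roots z)))%E.
Proof.
move=> t1 cK Kt e0; apply: contrapT => nN.
have t0 : 0 < t by lra.
have lt0 : 0 < ln t by rewrite ln_gt0.
pose small n (z : 'I_n -> R[i]) :=
  (area (lemniscate (poly_of_roots z)) < (expR (- n%:R * (2 * (ln t + e))))%:E)%E.
pose bad n := exists2 z : 'I_n -> R[i], tuples_in K n z & small n z.
have often N : exists2 n, (N <= n)%N & bad n.
  apply: contrapT => nb; apply: nN; exists N => n z Nn zK.
  rewrite leNgt; apply/negP => lz.
  by apply: nb; exists n => //; exists z.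
have [z0 Kz0] := capacity_gt0_nonempty t0 Kt.
have /choice[Z ZP] : forall n, exists Zn : nat -> R[i], (forall j, K (Zn j)) /\
    (bad n -> small n (fun j => Zn j)).
  move=> n; have [[z zK zs]|nb] := pselect (bad n); last by exists (fun=> z0).
  exists (fun j => if insub j is Some i then z i else z0); split.
    by move=> j; case: insubP => // i _ _; exact: zK.
  by move=> _; rewrite (_ : (fun j : 'I_n => _) = z)//; apply/funext => j; rewrite valK.
have ZK n j : K (Z n j) by case: (ZP n).
(* an ultrafilter living on the degrees with a small lemniscate *)
pose F0 := filter_from setT (fun N => [set n | (N <= n)%N /\ bad n]).
have F0_filter : ProperFilter F0.
  apply: filter_from_proper; last by move=> N _; have [n Nn bn] := often N; exists n.
  apply: filter_from_filter; first by exists 0%N.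
  move=> i j _ _; exists (maxn i j) => // n /= [+ bn].
  by rewrite geq_max => /andP[? ?].
have [F [FU F0F]] := ultraFilterLemma F0_filter.
have F_bad N : F [set n | (N <= n)%N /\ bad n] by apply: F0F; exists N.
have FF : Filter F by exact: filter_filter.
have F_tail N : F [set n | (N <= n)%N] by apply: filterS (F_bad N) => n [].
have [phi [mphi Kphi phi_roots phi_int]] := exists_weak_limit cK FU F_tail ZK.
(* the limit measure would have energy at least [a > ln t] *)
pose a := ln t + e / 2.
have [|mu muK] := @log_energy_pushforward_ge R K phi a cK mphi Kphi; last first.
  move=> /le_trans/(_ (log_energy_le t0 Kt muK)); rewrite lee_fin /a; lra.
move=> x c c0.
apply: contrapT => nint.
have /phi_int H : 0 < c^-1 by rewrite invr_gt0.
pose g w := trunc_ln c (modC (phi x - w)) - ln c.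
have g_lip z w : `|g z - g w| <= c^-1 * modC (z - w).
  rewrite /g opprB addrA subrK; apply: le_trans (trunc_ln_lipschitz _ _ c0) _.
  rewrite ler_pM2l ?invr_gt0//; apply: le_trans (ler_dist_modC _ _) _.
  by rewrite opprB addrC addrA subrK modCB.
have g_ge0 z : 0 <= g z by rewrite subr_ge0 trunc_ln_ge.
have [/(H g (a - ln c) g_lip g_ge0)//|avg] :=
  in_ultra_setVsetC [set n | a - ln c <= n%:R^-1 * \sum_(j < n) g (Z n j)] FU.
(* [e / 2] is spent in [a], [e / 4] on the potential near [phi x], and the last
   [e / 4] absorbs the constants for large [n] *)
pose d := e / 4.
have d0 : 0 < d by rewrite divr_gt0.
have de : e = 4 * d by rewrite /d; lra.
clearbody d.
have cd0 : 0 < c * d / 2 by rewrite divr_gt0// mulr_gt0.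
pose N := (Num.bound ((`|ln c - ln (c * d / 2)| + `|ln 2 - ln c|) / d)).+1.
have [n [[navg [j jn zx]] [Nn bn]]] :=
  filter_ex (filterI (filterI avg (phi_roots x _ cd0)) (F_bad N)).
have n0 : (0 < n)%N by exact: leq_ltn_trans jn.
have nR : 0 < n%:R :> R by rewrite ltr0n.
have nd : `|ln c - ln (c * d / 2)| + `|ln 2 - ln c| <= n%:R * d.
  rewrite -ler_pdivrMr//; apply: le_trans (ltW (archi_boundP _)) _.
    by rewrite divr_ge0 ?addr_ge0// ltW.
  by rewrite ler_nat; exact: leq_trans (ltnW (ltnSn _)) Nn.
have navg' : n%:R^-1 * \sum_(k < n) trunc_ln c (modC (phi x - Z n k)) <= a.
  move: navg => /= /negP; rewrite -ltNge /g sumrB sumr_const card_ord mulrBr.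
  by rewrite -[ln c *+ n]mulr_natl mulKf ?gt_eqF//; lra.
have nlt : 0 <= n%:R * ln t by rewrite mulr_ge0// ltW.
have rle : expR (ln c - n%:R * (a + d)) <= c * d / 2.
  rewrite -[leRHS]lnK ?posrE// ler_expR /a.
  have := ler_norm (ln c - ln (c * d / 2)); have := normr_ge0 (ln 2 - ln c).
  have : n%:R * (ln t + e / 2 + d) = n%:R * ln t + 3 * (n%:R * d).
    by rewrite de; lra.
  have : 0 <= n%:R * d by rewrite mulr_ge0// ltW.
  lra.
have := area_ge_of_truncated_mean (j := Ordinal jn) c0 d0 navg' zx rle.
rewrite leNgt => /negP; apply; have [_ /(_ bn)] := ZP n.
move=> /lt_le_trans; apply; rewrite lee_fin.
rewrite -[X in _ / X](@lnK _ 2) ?posrE// -expRB -expRM_natl ler_expR /a.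
have := ler_norm (ln 2 - ln c); have := normr_ge0 (ln c - ln (c * d / 2)).
have : n%:R * (ln t + e / 2 + d) = n%:R * (ln t + e) - n%:R * d by rewrite de; lra.
lra.
Qed.

End AreaLowerBound.

(** * Asymptotics *)

Section Conclusion.
Variable R : realType.
Implicit Types (K : set (planeC R)) (t : R).

Lemma ler_mean_lne (n : nat) (r : R) (A : \bar R) : (0 < n)%N ->
  ((expR (n%:R * r))%:E <= A)%E -> (r%:E <= (n%:R^-1)%:E * lne A)%E.
Proof.
move=> n0 rA; have nR : 0 < n%:R :> R by rewrite ltr0n.
have -> : r%:E = ((n%:R^-1)%:E * lne (expR (n%:R * r))%:E)%E.
  by rewrite lne_EFin ?expR_gt0// expRK -EFinM mulKf// gt_eqF.
have e0 : (0%R <= (expR (n%:R * r))%:E)%E by rewrite lee_fin expR_ge0.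
apply: lee_wpmul2l; first by rewrite lee_fin invr_ge0 ltW.
by rewrite lee_lne// in_itv/= ?leey ?andbT ?(le_trans e0).
Qed.

Lemma ger_mean_lne (n : nat) (r : R) (A : \bar R) : (0 < n)%N -> (0 <= A)%E ->
  (A <= (expR (n%:R * r))%:E)%E -> ((n%:R^-1)%:E * lne A <= r%:E)%E.
Proof.
move=> n0 A0 rA; have nR : 0 < n%:R :> R by rewrite ltr0n.
have -> : r%:E = ((n%:R^-1)%:E * lne (expR (n%:R * r))%:E)%E.
  by rewrite lne_EFin ?expR_gt0// expRK -EFinM mulKf// gt_eqF.
apply: lee_wpmul2l; first by rewrite lee_fin invr_ge0 ltW.
by rewrite lee_lne// in_itv/= leey andbT// lee_fin expR_ge0.
Qed.

Lemma cvge_near_interval (u : nat -> \bar R) (l : R) :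
  (forall e, 0 < e -> \forall n \near \oo, ((l - e)%:E <= u n <= (l + e)%:E)%E) ->
  u n @[n --> \oo] --> l%:E.
Proof.
move=> H; apply/fine_cvgP; split.
  have := H 1 ltr01; apply: filterS => n /andP[h1 h2].
  by rewrite fin_real// (lt_le_trans _ h1) ?ltNyr//= (le_lt_trans h2) ?ltry.
apply/cvgrPdist_le => e e0; have := H e e0; apply: filterS => n /=.
case: (u n) => [r| |]; rewrite ?leye_eq ?leeNy_eq ?andbF//=.
by rewrite !lee_fin distrC ler_distl.
Qed.

Lemma area_ge0 (A : set R[i]) : (0%R <= area A)%E.
Proof. exact: measure_ge0. Qed.

(** Within the lemniscate some root is at distance at most [n / t ^ (n - 1)], so
    the area is at most [4 n^3 t^2] times [t ^ (- 2 n)]. *)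
Lemma area_fekete_eventually_le K t (f : nat -> {poly R[i]}) (e : R) :
  1 < t -> compact K -> capacity K = t%:E ->
  (forall n, (0 < n)%N -> fekete_poly K n (f n)) -> 0 < e ->
  \forall n \near \oo, (area (lemniscate (f n)) <= (expR (n%:R * (- 2 * ln t + e)))%:E)%E.
Proof.
move=> t1 cK Kt fF e0; have t0 : 0 < t by lra.
(* [4 n^3 t^2 <= (n e)^4 / 4! <= exp (n e)] from this rank on *)
exists (Num.bound (96 * t ^+ 2 / e ^+ 4)).+1 => // n /= Nn.
have n0 : (0 < n)%N by exact: leq_trans Nn.
have nR : 0 < n%:R :> R by rewrite ltr0n.
have [z zF ->] := fF n n0.
have D0 : 0 < t ^+ n.-1 by rewrite exprn_gt0.
have deriv := fekete_derivative_ge t1 cK Kt zF.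
have near_roots x := lemniscate_near_roots n0 D0 deriv (x := x).
apply: le_trans (area_lemniscate_le _ near_roots) _.
  by rewrite divr_ge0// ltW.
rewrite lee_fin mulrDr mulrA [_ * -2]mulrC -mulrA expRD.
have en : 96 * t ^+ 2 <= n%:R * e ^+ 4.
  rewrite -ler_pdivrMr ?exprn_gt0//; apply: le_trans (ltW (archi_boundP _)) _.
    by rewrite divr_ge0 ?exprn_ge0 ?mulr_ge0 ?exprn_ge0// ltW.
  by rewrite ler_nat ltnW.
have -> : expR (- 2 * (n%:R * ln t)) = (t ^+ n) ^- 2.
  by rewrite mulNr expRN !expRM_natl lnK// posrE.
have -> : n%:R * (2 * (n%:R / t ^+ n.-1)) ^+ 2 = (t ^+ n) ^- 2 * (4 * t ^+ 2 * n%:R ^+ 3).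
  have tn : t ^+ n = t * t ^+ n.-1 by rewrite -exprS prednK.
  by rewrite tn; field; rewrite !gt_eqF.
rewrite ler_pM2l ?invr_gt0 ?exprn_gt0//.
have ne0 : 0 <= n%:R * e by rewrite mulr_ge0// ltW.
have := expR_ge1Dxn 3 ne0; rewrite (_ : 4`! = 24)%N// exprMn => h.
have : n%:R ^+ 3 * (96 * t ^+ 2) <= n%:R ^+ 3 * (n%:R * e ^+ 4).
  by rewrite ler_pM2l ?exprn_gt0.
have : n%:R ^+ 4 * e ^+ 4 / 24 <= expR (n%:R * e) by lra.
have : n%:R ^+ 4 = n%:R ^+ 3 * n%:R :> R by rewrite exprSr.
move=> ->; lra.
Qed.

End Conclusion.

Theorem theorem3p3 (R : realType) (t : R) (K : set (planeC R))
    (f : nat -> {poly R[i]}) :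
  1 < t -> compact K -> capacity K = t%:E ->
  (forall n : nat, (0 < n)%N -> fekete_poly K n (f n)) ->
  ((n%:R^-1)%:E * lne (min_area K n))%E @[n --> \oo] --> (- 2 * ln t)%:E /\
  ((n%:R^-1)%:E * lne (area (lemniscate (f n))))%E @[n --> \oo]
    --> (- 2 * ln t)%:E.
Proof.
move=> t1 cK Kt fF.
have min_le n : (0 < n)%N -> (min_area K n <= area (lemniscate (f n)))%E.
  move=> n0; apply: ereal_inf_lbound; exists (f n) => //.
  by have [z [zK _] ->] := fF n n0; exists z.
have min_ge0 n : (0%R <= min_area K n)%E.
  by apply: le_ereal_inf_tmp => _ [p _ <-]; exact: area_ge0.
have lower e : 0 < e -> \forall n \near \oo,
    ((- 2 * ln t - e)%:E <= (n%:R^-1)%:E * lne (min_area K n))%E.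
  move=> e0; have e2 : 0 < e / 2 by lra.
  have [N HN] := area_lemniscate_eventually_ge t1 cK Kt e2.
  exists N.+1 => // n /= Nn; apply: ler_mean_lne; first exact: leq_trans Nn.
  apply: le_ereal_inf_tmp => _ [p [z zK ->] <-]; apply: le_trans (HN n z (ltnW Nn) zK).
  by rewrite lee_fin ler_expR; lra.
have upper e : 0 < e -> \forall n \near \oo,
    ((n%:R^-1)%:E * lne (area (lemniscate (f n))) <= (- 2 * ln t + e)%:E)%E.
  move=> e0; have := area_fekete_eventually_le t1 cK Kt fF e0.
  move=> /(filterI (nbhs_infty_gt 0)); apply: filterS => n [n0 h].
  exact: ger_mean_lne n0 (area_ge0 _) h.
have mono : \forall n \near \oo, ((n%:R^-1)%:E * lne (min_area K n) <=
    (n%:R^-1)%:E * lne (area (lemniscate (f n))))%E.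
  exists 1%N => // n /= n0; apply: lee_wpmul2l; first by rewrite lee_fin invr_ge0.
  by rewrite lee_lne ?min_le// in_itv/= leey andbT// area_ge0.
split; apply: cvge_near_interval => e e0.
- near=> n; apply/andP; split; first by near: n; exact: lower.
  apply: (@le_trans _ _ ((n%:R^-1)%:E * lne (area (lemniscate (f n))))%E).
    by near: n; exact: mono.
  by near: n; exact: upper.
- near=> n; apply/andP; split; last by near: n; exact: upper.
  apply: (@le_trans _ _ ((n%:R^-1)%:E * lne (min_area K n))%E).
    by near: n; exact: lower.
  by near: n; exact: mono.
Unshelve. all: by end_near. Qed.
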